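(* Let $m$ and $n$ be positive integers. There are only finitely many integral equivalence classes of $(m,n)$-polygons.
   Context: Let $M\cong\mathbb{Z}^2$, $N=\mathrm{Hom}(M,\mathbb{Z})$, $M_{\mathbb{R}}=M\otimes\mathbb{R}$, $N_{\mathbb{R}}=N\otimes\mathbb{R}$. A lattice polygon $P\subset M_{\mathbb{R}}$ is a two-dimensional convex hull of finitely many points of $M$. For a vertex $u$ of $P$ the normal cone is $\sigma(P,u)=\{v\in N_{\mathbb{R}}:\langle u'-u,v\rangle\ge 0\ \forall u'\in P\}$; its multiplicity is $|\det(v_1,v_2)|$ where $v_1,v_2\in N$ are its primitive generators. The multiplicity $\mathrm{mult}(P)$ of $P$ is the maximum of the multiplicities of its normal cones over all vertices. A lattice polygon $P$ is an $(m,n)$-polygon if it has at most $n$ lattice points on its boundary and $\mathrm{mult}(P)\le m$. Two lattice polygons are integrally equivalent if an affine map that maps one lattice bijectively onto the other maps one polygon onto the other. *)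

(* Defs.v *)
From HB Require Import structures.
From mathcomp Require Import all_boot all_order all_algebra.
From mathcomp Require Import all_classical all_reals all_analysis.

Set Implicit Arguments.
Unset Strict Implicit.
Unset Printing Implicit Defensive.

Import Order.TTheory GRing.Theory Num.Theory.
Import numFieldNormedType.Exports.

Local Open Scope classical_set_scope.
Local Open Scope card_scope.
Local Open Scope ring_scope.

(* After the choice of a basis, M = 'rV[int]_2 and M_R = 'rV[R]_2, while
   N = Hom(M, Z) = 'cV[int]_2 and N_R = 'cV[R]_2 consist of linear forms acting
   by multiplication on the right. *)

Definition realify (R : realType) (p q : nat) (A : 'M[int]_(p, q)) :
  'M[R]_(p, q) := map_mx intr A.
Arguments realify R {p q} A.

Definition lattice (R : realType) : set 'rV[R]_2 := range (realify R).
Arguments lattice R : clear implicits.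

Definition pairing (R : realType) (x : 'rV[R]_2) (v : 'cV[R]_2) : R :=
  (x *m v) 0 0.

Definition conv_hull (R : realType) (A : set 'rV[R]_2) : set 'rV[R]_2 :=
  [set x | exists (k : nat) (p : 'I_k -> 'rV[R]_2) (w : 'I_k -> R),
     [/\ forall i, A (p i), forall i, 0 <= w i, \sum_(i < k) w i = 1
       & x = \sum_(i < k) w i *: p i]].

Definition affine_hull (R : realType) (A : set 'rV[R]_2) : set 'rV[R]_2 :=
  [set x | exists (k : nat) (p : 'I_k -> 'rV[R]_2) (w : 'I_k -> R),
     [/\ forall i, A (p i), \sum_(i < k) w i = 1
       & x = \sum_(i < k) w i *: p i]].

(* The dimension of a convex set is that of its affine hull; in the plane it is
   two exactly when the affine hull is everything. *)
Definition two_dimensional (R : realType) (P : set 'rV[R]_2) : Prop :=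
  affine_hull P = setT.

Definition lattice_polygon (R : realType) (P : set 'rV[R]_2) : Prop :=
  (exists A : set 'rV[int]_2,
     finite_set A /\ P = conv_hull (realify R @` A))
  /\ two_dimensional P.

(* Vertices are the zero-dimensional faces: the points where some linear form
   attains its minimum over P and attains it nowhere else. *)
Definition is_vertex (R : realType) (P : set 'rV[R]_2) (u : 'rV[R]_2) : Prop :=
  P u /\ exists v : 'cV[R]_2,
    forall u', P u' -> u' <> u -> pairing u v < pairing u' v.

Definition normal_cone (R : realType) (P : set 'rV[R]_2) (u : 'rV[R]_2) :
  set 'cV[R]_2 := [set v | forall u', P u' -> 0 <= pairing (u' - u) v].

Definition primitive (v : 'cV[int]_2) : Prop :=
  v <> 0 /\ forall (k : int) (w : 'cV[int]_2), v = k *: w -> `|k| = 1.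

Definition primitive_generators (R : realType) (sigma : set 'cV[R]_2)
    (v1 v2 : 'cV[int]_2) : Prop :=
  [/\ primitive v1, primitive v2 &
      sigma = [set x | exists a b : R, [/\ 0 <= a, 0 <= b
                 & x = a *: realify R v1 + b *: realify R v2]]].

(* The normal cone at a vertex of a lattice polygon is two-dimensional, strictly
   convex and rational, so that v1 and v2 exist and are unique up to order, and
   d is uniquely determined; for other cones the value is of no interest. *)
Definition cone_mult (R : realType) (sigma : set 'cV[R]_2) : nat :=
  xget 0%N [set d | exists v1 v2 : 'cV[int]_2,
    primitive_generators sigma v1 v2
    /\ d = `|\det (row_mx v1 v2 : 'M[int]_2)|%N].

(* A lattice polygon has finitely many vertices, and at least one, so the
   maximum exists. *)
Definition mult (R : realType) (P : set 'rV[R]_2) : nat :=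
  let ms := [set cone_mult (normal_cone P u) | u in is_vertex P] in
  xget 0%N (ms `&` ubound ms).

Definition boundary (R : realType) (P : set 'rV[R]_2) : set 'rV[R]_2 :=
  closure P `\` interior P.

Definition mn_polygon (R : realType) (m n : nat) (P : set 'rV[R]_2) : Prop :=
  [/\ lattice_polygon P, (boundary P `&` lattice R) #<= `I_n
    & (mult P <= m)%N].

Definition affine_map (R : realType) (f : 'rV[R]_2 -> 'rV[R]_2) : Prop :=
  exists (L : {linear 'rV[R]_2 -> 'rV[R]_2}) (b : 'rV[R]_2),
    f = (fun x => L x + b).

Definition integrally_equivalent (R : realType) (P Q : set 'rV[R]_2) : Prop :=
  exists f : 'rV[R]_2 -> 'rV[R]_2,
    [/\ affine_map f, set_bij (lattice R) (lattice R) f & f @` P = Q].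

Definition integral_class (R : realType) (P : set 'rV[R]_2) :
  set (set 'rV[R]_2) :=
  [set Q | lattice_polygon Q /\ integrally_equivalent P Q].

(* Main.v *)
(** Walk around the boundary of an (m, n)-polygon: the edge vectors E_1, ..., E_k
    have k <= n, sum to zero, and their directions turn around the origin once.
    The normal cone between two consecutive edges is generated by their primitive
    conormals, and an edge has lattice length at most n, so consecutive cross
    products lie in [1, n^2 m].

    The heart of the proof is that then all cross products of edge vectors are
    bounded. For a vector t with neighbours p and q and 0 < p x q <= 2D one can
    delete t and rescale the others, because
    (p x q) t = (t x q) p + (p x t) q; this lengthens the edges p and q until they
    meet, and keeps the vectors integral. If all the p x q are positive, the t
    that maximises (t x a) for some fixed a has p x q <= 2D. If some p x q <= 0,
    all vectors but t lie in the half-plane to the left of q, so their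
    heights above q sum to at most D, and the successor of q can be deleted
    unless at most four vectors are left.

    Finally the sum over all edges of E_i x (y - p_i) does not depend on y, so each
    nonnegative term is bounded for all y in the polygon; two consecutive edges
    brought into Hermite normal form thus confine the polygon to a fixed box. *)

Require Import Defs.
From HB Require Import structures.
From mathcomp Require Import all_boot all_order all_algebra.
From mathcomp Require Import all_classical all_reals all_analysis.
From mathcomp Require Import zify ring.

Set Implicit Arguments.
Unset Strict Implicit.
Unset Printing Implicit Defensive.

Import Order.TTheory GRing.Theory Num.Theory.
Import numFieldNormedType.Exports.

Local Open Scope classical_set_scope.
Local Open Scope card_scope.
Local Open Scope ring_scope.

(** * Rays around the origin *)

Lemma ord2P (i : 'I_2) : i = 0 \/ i = 1.
Proof. by case: i => -[|[|//]] lt; [left | right]; apply: val_inj. Qed.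

Definition cross (K : comNzRingType) (u v : 'rV[K]_2) : K :=
  u 0 0 * v 0 1 - u 0 1 * v 0 0.

Section Cross.
Variable K : comNzRingType.
Implicit Types (u v w : 'rV[K]_2) (a : K).

Lemma crossC u v : cross u v = - cross v u.
Proof. rewrite /cross; ring. Qed.

Lemma crossvv u : cross u u = 0.
Proof. rewrite /cross; ring. Qed.

Lemma crossDr u v w : cross u (v + w) = cross u v + cross u w.
Proof. rewrite /cross !mxE; ring. Qed.

Lemma crossDl u v w : cross (v + w) u = cross v u + cross w u.
Proof. rewrite /cross !mxE; ring. Qed.

Lemma crossBr u v w : cross u (v - w) = cross u v - cross u w.
Proof. rewrite /cross !mxE; ring. Qed.

Lemma crossZr a u v : cross u (a *: v) = a * cross u v.
Proof. rewrite /cross !mxE; ring. Qed.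

Lemma crossZl a u v : cross (a *: u) v = a * cross u v.
Proof. rewrite /cross !mxE; ring. Qed.

Lemma cross0r u : cross u 0 = 0.
Proof. rewrite /cross !mxE; ring. Qed.

Lemma cross_sumr u I (r : seq I) (P : pred I) (F : I -> 'rV[K]_2) :
  cross u (\sum_(i <- r | P i) F i) = \sum_(i <- r | P i) cross u (F i).
Proof.
apply: (big_morph (cross u)) => [v w|]; [exact: crossDr | exact: cross0r].
Qed.

Lemma row2P u v : u 0 0 = v 0 0 -> u 0 1 = v 0 1 -> u = v.
Proof.
move=> e0 e1; apply/rowP => i.
by have [->|->] := ord2P i.
Qed.

(** Cramer's rule in the plane: one vector is expanded in two others, with cross products as
    coefficients. *)
Lemma cross_pluckerv u v w :
  cross u w *: v = cross v w *: u + cross u v *: w.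
Proof. by apply: row2P; rewrite /cross !mxE; ring. Qed.

Lemma cross_plucker u v w x :
  cross u w * cross x v = cross v w * cross x u + cross u v * cross x w.
Proof. rewrite /cross; ring. Qed.

End Cross.

Section Fan.
Variable T : finType.
Implicit Types (I : {set T}) (E : T -> 'rV[int]_2) (D : int).

(** [E b] is the next ray counterclockwise, less than half a turn away. The last clause keeps every
    other ray out of the closed sector, so no third ray shares the direction of either. *)
Definition succ_ray I E (a b : T) : Prop :=
  [/\ a \in I, b \in I, 0 < cross (E a) (E b) &
      forall c, c \in I -> c != a -> c != b ->
        cross (E a) (E c) < 0 \/ cross (E c) (E b) < 0].

(** Indexing by a subset [I] of a fixed type lets a ray be deleted as [I :\ t]. The empty sectors
    between neighbours encode that the rays turn around the origin only once. *)
Definition fan D I E : Prop :=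
  [/\ \sum_(a in I) E a = 0,
      forall a, a \in I ->
        exists b, succ_ray I E a b /\ cross (E a) (E b) <= D &
      forall b, b \in I ->
        exists a, succ_ray I E a b /\ cross (E a) (E b) <= D].

(** Two successors of [a] both lie to its left and outside each other's sector, which would make
    their cross product negative in both orders. *)
Lemma succ_ray_inj_r I E a b b' :
  succ_ray I E a b -> succ_ray I E a b' -> b = b'.
Proof.
move=> [aI bI ab H] [_ b'I ab' H'].
apply/eqP/negPn/negP => nb.
have ba : b != a by apply/eqP => e; rewrite e crossvv in ab.
have b'a : b' != a by apply/eqP => e; rewrite e crossvv in ab'.
have := H _ b'I b'a; rewrite eq_sym => /(_ nb).
have := H' _ bI ba nb.
rewrite (crossC (E b')); move: ab ab'; clear; lia.
Qed.

Lemma succ_ray_inj_l I E a a' b :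
  succ_ray I E a b -> succ_ray I E a' b -> a = a'.
Proof.
move=> [aI bI ab H] [a'I _ ab' H'].
apply/eqP/negPn/negP => nb.
have ba : a != b by apply/eqP => e; rewrite e crossvv in ab.
have b'a : a' != b by apply/eqP => e; rewrite e crossvv in ab'.
have a'a : a' != a by rewrite eq_sym.
have := H _ a'I a'a b'a.
have := H' _ aI nb ba.
rewrite (crossC (E a')); move: ab ab'; clear; lia.
Qed.

Lemma fan_sum D I E v : fan D I E -> \sum_(a in I) cross v (E a) = 0.
Proof. by case=> s0 _ _; rewrite -cross_sumr s0 cross0r. Qed.

(** * Deleting a ray whose neighbours are less than half a turn apart *)

Section Removal.
Variables (D : int) (I : {set T}) (E : T -> 'rV[int]_2) (p t q : T).
Hypotheses (fanE : fan D I E) (pt : succ_ray I E p t) (tq : succ_ray I E t q).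
Let c := cross (E p) (E q).
Hypotheses (c_gt0 : 0 < c) (c_le : c <= 2 * D).

Let D1 : 1 <= D.
Proof. by move: c_gt0 c_le; clear; lia. Qed.

(** Multiplying the zero sum by [c] and expanding [c *: E t] in [E p] and [E q] gives these
    weights. *)
Let wt x : int :=
  c + (x == p)%:R * cross (E t) (E q) + (x == q)%:R * cross (E p) (E t).

Let pt_le : cross (E p) (E t) <= D.
Proof.
case: fanE => _ + _; have [pI _ _ _] := pt.
by move=> /(_ _ pI)[b [] /(succ_ray_inj_r pt) <-].
Qed.

Let tq_le : cross (E t) (E q) <= D.
Proof.
case: fanE => _ + _; have [pI _ _ _] := tq.
by move=> /(_ _ pI)[b [] /(succ_ray_inj_r tq) <-].
Qed.

Let pt_gt0 : 0 < cross (E p) (E t). Proof. by case: pt. Qed.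
Let tq_gt0 : 0 < cross (E t) (E q). Proof. by case: tq. Qed.

Let npq : p != q.
Proof. by apply: contraTneq c_gt0 => e; rewrite /c e crossvv ltxx. Qed.
Let npt : p != t.
Proof. by apply: contraTneq pt_gt0 => e; rewrite e crossvv ltxx. Qed.
Let nqt : q != t.
Proof. by apply: contraTneq tq_gt0 => e; rewrite e crossvv ltxx. Qed.

(** As [p] and [q] differ, at most one correction of size at most [D] is added to [c <= 2 * D]. *)
Let wt_bound x : 1 <= wt x <= 3 * D.
Proof.
rewrite /wt; have [->|_] := eqVneq x p.
  rewrite (negbTE npq); lia.
have [_|_] := eqVneq x q; lia.
Qed.

Let wt_gt0 x : 0 < wt x. Proof. have := wt_bound x; lia. Qed.

Let succ_scale J a b : succ_ray J E a b ->
  succ_ray J (fun x => wt x *: E x) a b.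
Proof.
case=> aJ bJ ab H; split => // [|x xJ xa xb].
  by rewrite crossZl crossZr !pmulr_rgt0.
by rewrite !(crossZl, crossZr) !pmulr_rlt0 //; apply: H.
Qed.

(** The constant is [3 * D * (3 * D) * (2 * D)]: two weights and a cross product, for which [2 * D]
    is allowed because of the new neighbours [p] and [q]. *)
Let wt_le a b : cross (E a) (E b) <= 2 * D ->
  cross (wt a *: E a) (wt b *: E b) <= 18 * D ^+ 3.
Proof.
rewrite crossZl crossZr => H.
have := wt_bound a; have := wt_bound b => /andP[b1 b2] /andP[a1 a2].
have ab : 0 <= wt a * wt b <= (3 * D) * (3 * D).
  rewrite mulr_ge0 ?ler_pM //; by move: a1 b1; clear; lia.
rewrite mulrA; apply: (@le_trans _ _ (wt a * wt b * (2 * D))).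
  by rewrite ler_wpM2l //; case/andP: ab.
apply: (@le_trans _ _ (3 * D * (3 * D) * (2 * D))).
  by rewrite ler_wpM2r //; [lia | case/andP: ab].
by rewrite le_eqVlt; apply/orP; left; apply/eqP; ring.
Qed.

(** A ray in the sector from [p] to [q] lies on one side of [t], hence in one of two sectors already
    known to be empty. *)
Let pq : succ_ray (I :\ t) E p q.
Proof.
have [pI tI _ Hpt] := pt; have [_ qI _ Htq] := tq.
split; rewrite ?inE ?npt ?nqt //= => x /setD1P[xt xI] xp xq.
have := Hpt _ xI xp xt; have := Htq _ xI xt xq.
rewrite (crossC (E t) (E x)); clear; lia.
Qed.

Let succ_sub a b : a != t -> b != t -> succ_ray I E a b ->
  succ_ray (I :\ t) E a b.
Proof.
move=> at_ bt [aI bI ab H]; split; rewrite ?inE ?at_ ?bt //.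
by move=> x /setD1P[_ xI]; apply: H.
Qed.

Lemma fan_removal : exists w : T -> int,
  (forall x, 1 <= w x) /\
  fan (18 * D ^+ 3) (I :\ t) (fun x => w x *: E x).
Proof.
exists wt; split => [x|]; first by have := wt_bound x; lia.
have [pI tI _ Hpt] := pt; have [_ qI _ Htq] := tq.
have [s0 nx pv] := fanE.
split.
- have pI' : p \in I :\ t by rewrite !inE npt.
  have qI' : q \in I :\ t by rewrite !inE nqt.
  rewrite (eq_bigr (fun x => c *: E x +
    ((if x == p then cross (E t) (E q) *: E x else 0)
     + (if x == q then cross (E p) (E t) *: E x else 0)))); last first.
    move=> x _; rewrite /wt 2!scalerDl -addrA; congr (_ + (_ + _)).
      by case: (x == p); rewrite /= ?mul1r ?mul0r ?scale0r.
    by case: (x == q); rewrite /= ?mul1r ?mul0r ?scale0r.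
  rewrite !big_split /= -scaler_sumr -!big_mkcondr /=.
  have pick r d : r \in I :\ t ->
      \sum_(i in I :\ t | i == r) d *: E i = d *: E r.
    move=> rI; rewrite (big_pred1 r) // => x /=.
    by rewrite andbC; case: eqP => // ->.
  rewrite !pick //.
  (* The two corrections add up to [c *: E t], so the weighted sum is [c] times the original one. *)
  rewrite -cross_pluckerv -/c -scalerDr addrC.
  have <- : \sum_(a in I) E a = E t + \sum_(i in I :\ t) E i.
    rewrite (bigD1 t) //=; congr (_ + _); apply: eq_bigl => x.
    by rewrite !inE andbC.
  by rewrite s0 scaler0.
- move=> a /setD1P[at_ aI]; have [ap|ap] := eqVneq a p.
    exists q; rewrite ap; split; first exact: succ_scale.
    exact: wt_le.
  have [b [ab abD]] := nx a aI; exists b; split.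
    apply/succ_scale/succ_sub => //.
    apply: contraNneq ap => bt; apply/eqP.
    by apply: (succ_ray_inj_l ab); rewrite bt.
  by apply: wt_le; move: abD D1; clear; lia.
- move=> b /setD1P[bt bI]; have [bq|bq] := eqVneq b q.
    exists p; rewrite bq; split; first exact: succ_scale.
    exact: wt_le.
  have [a [ab abD]] := pv b bI; exists a; split.
    apply/succ_scale/succ_sub => //.
    apply: contraNneq bq => at_; apply/eqP.
    by apply: (succ_ray_inj_r ab); rewrite at_.
  by apply: wt_le; move: abD D1; clear; lia.
Qed.

(** Weights of at least 1 do not shrink cross products, so [F] covers the pairs without [t]. For the
    others, Cramer's rule turns [c * cross (E t) (E b)] into two products of size at most [D * F],
    and [c] is at least 1. *)
Lemma removal_bound (F : int) (w : T -> int) :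
  (forall x, 1 <= w x) ->
  (forall a b, a \in I :\ t -> b \in I :\ t ->
     `|cross (w a *: E a) (w b *: E b)| <= F) ->
  forall a b, a \in I -> b \in I -> `|cross (E a) (E b)| <= 2 * D * F.
Proof.
move=> w1 H.
have [pI tI _ Hpt] := pt; have [_ qI _ Htq] := tq.
have H1 a b : a != t -> b != t -> a \in I -> b \in I ->
    `|cross (E a) (E b)| <= F.
  move=> at_ bt aI bI; have := H a b; rewrite !inE at_ bt => /(_ aI bI).
  rewrite crossZl crossZr !normrM; apply: le_trans.
  rewrite mulrA ler_peMl // -[1]mulr1; apply: ler_pM => //;
    by rewrite ler_normr w1.
have F0 : 0 <= F by apply: le_trans (H1 p p _ _ _ _).
have H2 b : b != t -> b \in I -> `|cross (E t) (E b)| <= 2 * D * F.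
  move=> bt bI; apply: (@le_trans _ _ `|c * cross (E t) (E b)|).
    by rewrite normrM ler_peMl // ler_normr -gtz0_ge1 c_gt0.
  have -> : c * cross (E t) (E b) = cross (E t) (E q) * cross (E p) (E b)
     + cross (E p) (E t) * cross (E q) (E b).
    by rewrite /c /cross; ring.
  apply: le_trans (ler_normD _ _) _.
  rewrite !normrM [X in X * _ + _]gtr0_norm // [X in _ + X * _]gtr0_norm //.
  rewrite (_ : 2 * D * F = D * F + D * F); last by ring.
  apply: lerD; apply: ler_pM => //;
    by [apply: ltW | apply: H1].
move=> a b aI bI.
have [->|at_] := eqVneq a t; have [->|bt] := eqVneq b t.
- by rewrite crossvv normr0 !mulr_ge0 // (le_trans _ D1).
- exact: H2.
- by rewrite crossC normrN; apply: H2.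
apply: (le_trans (H1 _ _ at_ bt aI bI)); rewrite ler_peMl //.
by move: D1; clear; lia.
Qed.

End Removal.

(** * A ray whose neighbours are at least half a turn apart *)

Section Reflex.
Variables (D : int) (I : {set T}) (E : T -> 'rV[int]_2) (p t q : T).
Hypotheses (fanE : fan D I E) (pt : succ_ray I E p t) (tq : succ_ray I E t q).
Hypothesis c_le0 : cross (E p) (E q) <= 0.

(** The sectors from [p] to [t] and from [t] to [q] fill at least half a turn, so [y] lies in the
    remaining open sector from [q] to [p], at most half a turn wide. *)
Lemma reflex_sign y : y \in I -> y != p -> y != t -> y != q ->
  0 < cross (E q) (E y) /\ 0 < cross (E y) (E p).
Proof.
move=> yI yp yt yq.
have [_ _ pt0 /(_ y yI yp yt)] := pt; have [_ _ tq0 /(_ y yI yt yq)] := tq.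
have := cross_plucker (E p) (E t) (E q) (E y).
rewrite (crossC (E p) (E y)) (crossC (E t) (E y)) (crossC (E q) (E y)).
move: (cross (E p) (E q)) c_le0 (cross (E p) (E t)) pt0 (cross (E t) (E q)) tq0.
move: (cross (E y) (E p)) (cross (E y) (E t)) (cross (E y) (E q)).
move=> yp' yt' yq' c c0 pt' pt0' tq' tq0' H h1 h2; split.
  rewrite oppr_gt0 ltNge; apply/negP => yq0.
  have yt0 : 0 < yt' by lia.
  have yp0 : 0 < yp' by lia.
  have := mulr_le0_ge0 c0 (ltW yt0).
  have := mulr_gt0 tq0' yp0; have := mulr_ge0 (ltW pt0') yq0; lia.
rewrite ltNge; apply/negP => yp0.
have yt0 : yt' < 0 by lia.
have yq0 : yq' < 0 by lia.
have := mulr_le0 c0 (ltW yt0).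
have := mulr_ge0_le0 (ltW tq0') yp0.
have : pt' * yq' < 0 by rewrite pmulr_rlt0.
lia.
Qed.

(** All rays but [t] have nonnegative height above [q]; since the rays sum to zero, these heights
    add up to [cross (E t) (E q)]. *)
Lemma reflex_le_r y : y \in I -> `|cross (E q) (E y)| <= D.
Proof.
move=> yI; have [pI tI pt0 _] := pt; have [_ qI tq0 _] := tq.
have tqD : cross (E t) (E q) <= D.
  have [_ + _] := fanE; move=> /(_ _ tI)[b [] /(succ_ray_inj_r tq) <- //].
have fge x : x \in I -> x != t -> 0 <= cross (E q) (E x).
  move=> xI xt; have [->|xq] := eqVneq x q; first by rewrite crossvv.
  have [->|xp] := eqVneq x p; first by rewrite crossC oppr_ge0.
  by have [/ltW] := reflex_sign xI xp xt xq.
have [->|yt] := eqVneq y t; first by rewrite crossC; lia.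
rewrite ger0_norm; last exact: fge.
have := fan_sum (E q) fanE; rewrite (bigD1 t) //= (bigD1 y) /=; last first.
  by rewrite yI.
set s := \sum_(i | _) _.
have s0 : 0 <= s by apply: sumr_ge0 => x /andP[/andP[xI xt] _]; apply: fge.
rewrite crossC; lia.
Qed.

Lemma reflex_le_l y : y \in I -> `|cross (E y) (E p)| <= D.
Proof.
move=> yI; have [pI tI pt0 _] := pt; have [_ qI tq0 _] := tq.
have tqD : cross (E p) (E t) <= D.
  have [_ + _] := fanE; move=> /(_ _ pI)[b [] /(succ_ray_inj_r pt) <- //].
rewrite crossC normrN.
have fge x : x \in I -> x != t -> cross (E p) (E x) <= 0.
  move=> xI xt; have [->|xq] := eqVneq x q; first exact: c_le0.
  have [->|xp] := eqVneq x p; first by rewrite crossvv.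
  by have [_] := reflex_sign xI xp xt xq; rewrite crossC oppr_gt0 => /ltW.
have [->|yt] := eqVneq y t; first by lia.
rewrite ler0_norm; last exact: fge.
have := fan_sum (E p) fanE; rewrite (bigD1 t) //= (bigD1 y) /=; last first.
  by rewrite yI.
set s := \sum_(i | _) _.
have s0 : s <= 0 by apply: sumr_le0 => x /andP[/andP[xI xt] _]; apply: fge.
lia.
Qed.

(** Let [x] follow [q] and [z] follow [x]. If [x] or [z] is [p], only [p], [t], [q] and [x] are
    left; otherwise [z] lies strictly to the left of [q], and [x] can be deleted. *)
Lemma reflex_cases :
  (exists x z, [/\ succ_ray I E q x, succ_ray I E x z
    & 0 < cross (E q) (E z) <= D])
  \/ forall a b, a \in I -> b \in I -> `|cross (E a) (E b)| <= 2 * D.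
Proof.
have [pI tI pt0 Hpt] := pt; have [_ qI tq0 Htq] := tq.
have tqD : cross (E t) (E q) <= D.
  have [_ + _] := fanE; move=> /(_ _ tI)[b [] /(succ_ray_inj_r tq) <- //].
have ptD : cross (E p) (E t) <= D.
  have [_ + _] := fanE; move=> /(_ _ pI)[b [] /(succ_ray_inj_r pt) <- //].
(* With at most four rays, only the pair [t], [x] escapes the two preceding bounds; crossing the
   zero sum with [E t] settles it. Taking [x = t] covers three rays. *)
have small x : (x = t \/ x \in I) ->
    (forall y, y \in I -> [|| y == p, y == t, y == q | y == x]) ->
    forall a b, a \in I -> b \in I -> `|cross (E a) (E b)| <= 2 * D.
  move=> xI Iall.
  have tx : `|cross (E t) (E x)| <= 2 * D.
    case: xI => [->|xI]; first by rewrite crossvv; lia.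
    have [->|xt] := eqVneq x t; first by rewrite crossvv; lia.
    have [->|xp] := eqVneq x p; first by rewrite crossC; lia.
    have [->|xq] := eqVneq x q; first by lia.
    have qp : q != p.
      by apply: contraTneq pt0 => <-; rewrite crossC oppr_gt0 -leNgt ltW.
    have := fan_sum (E t) fanE.
    rewrite (bigD1 p) //= (bigD1 q) /= ?qI // (bigD1 x) /= ?xI ?xp //.
    rewrite big1 => [|y /andP[/andP[/andP[yI yp] yq] yx]]; last first.
      have := Iall y yI; rewrite (negbTE yp) (negbTE yq) (negbTE yx) !orbF /=.
      by move=> /eqP->; rewrite crossvv.
    rewrite (crossC (E t) (E p)); move: ptD tqD pt0 tq0; clear; lia.
  have H1 a : a \in I -> `|cross (E p) (E a)| <= 2 * D.
    by move=> /reflex_le_l; rewrite crossC normrN; lia.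
  have H2 a : a \in I -> `|cross (E q) (E a)| <= 2 * D.
    by move=> /reflex_le_r; lia.
  move=> a b aI bI.
  have D0 : 0 <= 2 * D by move: ptD pt0; clear; lia.
  have [->|ap] := eqVneq a p; first exact: H1.
  have [->|aq] := eqVneq a q; first exact: H2.
  have [->|bp] := eqVneq b p; first by rewrite crossC normrN; exact: H1.
  have [->|bq] := eqVneq b q; first by rewrite crossC normrN; exact: H2.
  have := Iall a aI; have := Iall b bI.
  rewrite (negbTE ap) (negbTE aq) (negbTE bp) (negbTE bq) /=.
  by case/orP => /eqP-> /orP[]/eqP->; rewrite ?crossvv ?normr0 // crossC normrN.
have [_ nx pv] := fanE.
have [x [qx qxD]] := nx q qI.
have [_ xI qx0 Hqx] := qx.
have [xp|xp] := eqVneq x p.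
  right; apply: (small t); first by left.
  move=> y yI; apply/negPn/negP; rewrite !negb_or => /and4P[yp yt yq _].
  have := Hqx y yI yq; rewrite xp.
  move=> /(_ yp); have := reflex_sign yI yp yt yq; clear; lia.
have xt : x != t by apply: contraTneq qx0 => ->; rewrite crossC; lia.
have xq : x != q by apply: contraTneq qx0 => ->; rewrite crossvv.
have [z [xz xzD]] := nx x xI.
have [_ zI xz0 Hxz] := xz.
have [zp|zp] := eqVneq z p.
  right; apply: (small x); first by right.
  move=> y yI; apply/negPn/negP; rewrite !negb_or => /and4P[yp yt yq yx].
  have [y1 y2] := reflex_sign yI yp yt yq; have := Hqx y yI yq yx.
  have := Hxz y yI yx; rewrite zp => /(_ yp).
  rewrite (crossC (E x) (E y)); move: y1 y2; clear; lia.
have zt : z != t.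
  by apply: contraNneq xp => zt; rewrite zt in xz; rewrite (succ_ray_inj_l pt xz).
have zq : z != q.
  by apply: contraTneq xz0 => ->; rewrite crossC oppr_gt0 -leNgt ltW.
left; exists x, z; split => //.
have [z1 z2] := reflex_sign zI zp zt zq.
by rewrite z1 (le_trans (ler_norm _) (reflex_le_r zI)).
Qed.

End Reflex.

End Fan.

(** Induction on the number of rays: a deletion leaves a fan for [18 * D ^+ 3], whose bound [F]
    pulls back to [2 * D * F]. The alternative [2 * D] serves the case of at most four rays. *)
Lemma fan_bound (k : nat) (D : int) : exists F : int,
  forall (T : finType) (I : {set T}) (E : T -> 'rV[int]_2),
    (#|I| <= k)%N -> fan D I E ->
    forall a b, a \in I -> b \in I -> `|cross (E a) (E b)| <= F.
Proof.
elim: k D => [|k IH] D.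
  exists 0 => T I E; rewrite leqn0 cards_eq0 => /eqP-> _ a b.
  by rewrite inE.
have [F FP] := IH (18 * D ^+ 3).
exists (Num.max (2 * D * F) (2 * D)) => T I E Ik fanE a b aI bI.
have step p t q : succ_ray I E p t -> succ_ray I E t q ->
    0 < cross (E p) (E q) <= 2 * D ->
    `|cross (E a) (E b)| <= Num.max (2 * D * F) (2 * D).
  move=> pt tq /andP[c0 c1].
  have [w [w1 wP]] := fan_removal fanE pt tq c0 c1.
  rewrite le_max; apply/orP; left.
  apply: (removal_bound fanE pt tq c0 c1 w1) => //.
  have [_ tI _ _] := pt.
  by apply: FP wP; move: Ik; rewrite (cardsD1 t) tI.
have [[p [t [q [pt tq c0]]]]|good] := pselect (exists p t q,
  [/\ succ_ray I E p t, succ_ray I E t q & cross (E p) (E q) <= 0]).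
  have [[x [z [qx xz c]]]|small] := reflex_cases fanE pt tq c0.
    by apply: (step q x z) => //; have [_ _] := tq; lia.
  by rewrite le_max small ?orbT.
have [_ nx pv] := fanE.
(* The neighbours of every ray now have positive cross product. In the Plücker relation for [p],
   [j], [q], [a], each term is at most [D] times the maximum attained at [j], which then cancels;
   the predecessor of [a] shows that it is positive. *)
pose j := [arg max_(j > a in I) cross (E j) (E a)]%O.
have [jI jmax] : j \in I /\ forall i, i \in I ->
    cross (E i) (E a) <= cross (E j) (E a).
  by rewrite /j; case: arg_maxP => // i iI H; split.
have [p [pj pjD]] := pv j jI; have [q [jq jqD]] := nx j jI.
have c0 : 0 < cross (E p) (E q).
  by rewrite ltNge; apply/negP => c0; apply: good; exists p, j, q.
apply: (step p j q) => //; rewrite c0 /=.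
have [pI _ pj0 _] := pj; have [_ qI jq0 _] := jq.
have [r [ra _]] := pv a aI; have [rI _ ra0 _] := ra.
have f0 : 0 < cross (E j) (E a) := lt_le_trans ra0 (jmax r rI).
have := cross_plucker (E p) (E j) (E q) (E a).
rewrite !(crossC (E a)) !mulrN -opprD => /oppr_inj H.
rewrite -(ler_pM2r f0) H.
rewrite (_ : 2 * D * _ = D * cross (E j) (E a) + D * cross (E j) (E a));
  last by ring.
have mono d f : 0 < d -> d <= D -> f <= cross (E j) (E a) ->
    d * f <= D * cross (E j) (E a).
  move=> d0 dD fj; apply: (@le_trans _ _ (d * cross (E j) (E a))).
    by rewrite ler_pM2l.
  by rewrite ler_pM2r.
by apply: lerD; apply: mono => //; apply: jmax.
Qed.

(** * Walking around a finite point set *)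

Definition dot (K : comNzRingType) (u v : 'rV[K]_2) : K :=
  u 0 0 * v 0 0 + u 0 1 * v 0 1.

Section Dot.
Variable K : comNzRingType.
Implicit Types (u v w x : 'rV[K]_2).

Lemma dotBr u v w : dot u (v - w) = dot u v - dot u w.
Proof. rewrite /dot !mxE; ring. Qed.

Lemma dotZl (a : K) u v : dot (a *: u) v = a * dot u v.
Proof. rewrite /dot !mxE; ring. Qed.

Lemma dotDl u v w : dot (v + w) u = dot v u + dot w u.
Proof. rewrite /dot !mxE; ring. Qed.

Lemma dot_cross u w x :
  dot u u * cross w x = dot u w * cross u x - cross u w * dot u x.
Proof. rewrite /dot /cross; ring. Qed.

(** This relation makes the angular order transitive on the half-plane where [dot v] is positive. *)
Lemma dot_cross3 v a b x :
  dot v b * cross a x = dot v a * cross b x + dot v x * cross a b.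
Proof. rewrite /dot /cross; ring. Qed.

Definition rot u : 'rV[K]_2 := \row_j (if j == 0 then - u 0 1 else u 0 0).

Lemma dot_rot u x : dot (rot u) x = cross u x.
Proof. rewrite /dot /cross !mxE /=; ring. Qed.

Lemma cross_rot u : cross u (rot u) = dot u u.
Proof. rewrite /dot /cross !mxE /=; ring. Qed.

Lemma cross_dot v c x : dot v c * dot c x = dot v x * dot c c
  - cross c x * cross c v.
Proof. rewrite /dot /cross; ring. Qed.

End Dot.

Lemma dotvv_ge0 (K : realDomainType) (u : 'rV[K]_2) : 0 <= dot u u.
Proof. by rewrite /dot addr_ge0 // -expr2 sqr_ge0. Qed.

Lemma dotvv_gt0 (K : realDomainType) (u : 'rV[K]_2) : u != 0 -> 0 < dot u u.
Proof.
move=> u0; rewrite lt_neqAle dotvv_ge0 andbT eq_sym.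
apply: contraNneq u0; rewrite /dot => /eqP.
rewrite paddr_eq0 -?expr2 ?sqr_ge0 // !sqrf_eq0 => /andP[/eqP a /eqP b].
by apply/eqP/row2P; rewrite mxE.
Qed.

Lemma cross_dot_eq0 (u x : 'rV[int]_2) :
  u != 0 -> cross u x = 0 -> dot u x = 0 -> x = 0.
Proof.
move=> /dotvv_gt0 u0 c0 d0.
have H i : dot u u * x 0 i = 0.
  have [->|->] := ord2P i.
  - transitivity (u 0 0 * dot u x - u 0 1 * cross u x).
      by rewrite /dot /cross; ring.
    by rewrite c0 d0; ring.
  - transitivity (u 0 1 * dot u x + u 0 0 * cross u x).
      by rewrite /dot /cross; ring.
    by rewrite c0 d0; ring.
apply/rowP => i; rewrite mxE; apply/eqP.
by have /eqP := H i; rewrite mulf_eq0 gt_eqF.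
Qed.

Lemma scalez_eq0 (a : int) (v : 'rV[int]_2) : a != 0 -> a *: v = 0 -> v = 0.
Proof.
move=> a0 /rowP av; apply/rowP => i; have /eqP := av i.
by rewrite !mxE mulf_eq0 (negbTE a0) => /eqP.
Qed.

Lemma cross_cross_eq0 (u w x : 'rV[int]_2) :
  cross u w != 0 -> cross u x = 0 -> cross w x = 0 -> x = 0.
Proof.
move=> uw ux wx; have := cross_pluckerv u x w.
by rewrite (crossC x) wx ux oppr0 !scale0r addr0; apply: scalez_eq0.
Qed.

(** * Vertices and edges by gift wrapping *)

Section Polygon.
Variable s : seq 'rV[int]_2.
Implicit Types (a b c x : 'rV[int]_2).

Definition lattice_vertex b : Prop :=
  b \in s /\ exists v, forall x, x \in s -> x != b -> dot v b < dot v x.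

(* The polygon lies to the left of the edge from [b] to [c]; the last clause
   says that the segment is the whole edge. *)
Definition directed_edge b c : Prop :=
  [/\ b \in s, c \in s, b != c,
      forall x, x \in s -> 0 <= cross (c - b) (x - b)
    & forall x, x \in s -> cross (c - b) (x - b) = 0 ->
        0 <= dot (c - b) (x - b) /\ dot (c - b) (x - c) <= 0].

Lemma big_abs_bound (f : 'rV[int]_2 -> int) :
  exists2 K : int, 0 < K & forall x, x \in s -> `|f x| < K.
Proof.
exists (1 + \sum_(x <- s) `|f x|).
  by rewrite ltr_pwDl // sumr_ge0.
move=> x xs; rewrite (big_rem x) //=.
by rewrite addrCA ltrDl ltr_pwDl // sumr_ge0.
Qed.

(** With [K] above all values of [dot v (x - c)], the form [K *: w + v] compares lexicographically:
    first by [w], then by [v]. *)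
Lemma lattice_vertex_perturb b c (w v : 'rV[int]_2) : c \in s ->
  (forall x, x \in s -> 0 <= dot w (x - c)) ->
  (forall x, x \in s -> x != c -> dot w (x - c) = 0 -> 0 < dot v (x - c)) ->
  lattice_vertex c.
Proof.
move=> cs w_ge0 v_gt0; split=> //.
have [K K0 KP] := big_abs_bound (fun x => dot v (x - c)).
exists (K *: w + v) => x xs xc.
rewrite -subr_gt0 -dotBr dotDl dotZl.
have := w_ge0 x xs; rewrite le_eqVlt => /predU1P[/esym w0|w0].
  by rewrite w0 mulr0 add0r v_gt0.
have /ltr_normlP[vK _] := KP x xs; rewrite -ltrBlDr sub0r.
by apply: (lt_le_trans vK); rewrite ler_peMr -?gtz0_ge1 // ltW.
Qed.

(** The lexicographically smallest point is a vertex. *)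
Lemma lattice_vertex_exists x0 : x0 \in s -> exists b, lattice_vertex b.
Proof.
move=> x0s.
have min_seq (P : pred 'rV[int]_2) (f : 'rV[int]_2 -> int) x : x \in s -> P x ->
    exists b, [/\ b \in s, P b & forall y, y \in s -> P y -> f b <= f y].
  elim: s x => // h t IH x; rewrite inE.
  have [[y [yt Py]] _ _|none] := pselect (exists y, y \in t /\ P y).
    have [b [bt Pb bmin]] := IH y yt Py.
    have [fh|fh] := leP (f b) (f h).
      exists b; split; rewrite ?inE ?bt ?orbT // => z.
      by rewrite inE => /predU1P[->|/bmin].
    have [Ph|Ph] := boolP (P h).
      exists h; split; rewrite ?mem_head // => z.
      rewrite inE => /predU1P[->//|zt Pz].
      by apply/ltW/(lt_le_trans fh)/bmin.
    exists b; split; rewrite ?inE ?bt ?orbT // => z.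
    by rewrite inE => /predU1P[->|/bmin//]; rewrite (negbTE Ph).
  case/predU1P=> [-> Ph|xt Px]; last by case: none; exists x.
  exists h; split; rewrite ?mem_head // => z.
  rewrite inE => /predU1P[->//|zt Pz]; by case: none; exists z.
have [a [as_ _ amin]] := min_seq predT (fun x => x 0 0) x0 x0s isT.
have [c [cs /eqP ca cmin]] := min_seq (fun x => x 0 0 == a 0 0)
  (fun x => x 0 1) a as_ (eqxx _).
exists c; pose e0 : 'rV[int]_2 := \row_j (j == 0)%:R.
pose e1 : 'rV[int]_2 := \row_j (j == 1)%:R.
have e0E x : dot e0 x = x 0 0 by rewrite /dot !mxE /=; ring.
have e1E x : dot e1 x = x 0 1 by rewrite /dot !mxE /=; ring.
apply: (@lattice_vertex_perturb c c e0 e1) => // x xs.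
  by rewrite e0E !mxE subr_ge0 ca; apply: amin.
move=> xc; rewrite e0E e1E !mxE => /eqP; rewrite subr_eq0 ca => xa.
rewrite subr_gt0 lt_neqAle cmin // andbT; apply: contraNneq xc => e.
by apply/eqP/row2P => //; rewrite ca; apply/eqP.
Qed.

(** In an open half-plane directions are ordered by angle; the most clockwise one is taken and,
    among parallel ones, the longest. *)
Lemma extreme_direction (v : 'rV[int]_2) (t : seq 'rV[int]_2) :
  t != [::] -> (forall x, x \in t -> 0 < dot v x) ->
  exists2 c, c \in t & forall x, x \in t ->
    0 <= cross c x /\ (cross c x = 0 -> dot v x <= dot v c).
Proof.
elim: t => // h t IH _ vpos.
have [->|t0] := eqVneq t [::].
  exists h; first by rewrite mem_head.
  by move=> x; rewrite inE => /eqP->; rewrite crossvv.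
have [x xt|c ct cP] := IH t0; first by apply: vpos; rewrite inE xt orbT.
have vh : 0 < dot v h by apply: vpos; rewrite mem_head.
have vt x : x \in t -> 0 < dot v x by move=> xt; apply: vpos; rewrite inE xt orbT.
have [hc|hc] := ltP (cross c h) 0.
  exists h; first by rewrite mem_head.
  move=> x; rewrite inE => /predU1P[->|xt]; first by rewrite crossvv.
  have [cx _] := cP x xt; have := dot_cross3 v h c x.
  have hc' : 0 < cross h c by rewrite crossC oppr_gt0.
  have := mulr_gt0 (vt x xt) hc'; have := mulr_ge0 (ltW vh) cx => p1 p2 e.
  have : 0 < cross h x by rewrite -(pmulr_rgt0 _ (vt c ct)) e ltr_wpDl.
  by move=> hx; split; [exact: ltW | move=> e'; rewrite e' ltxx in hx].
have [hc0|hc0] := eqVneq (cross c h) 0; last first.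
  exists c; first by rewrite inE ct orbT.
  move=> x; rewrite inE => /predU1P[->|/cP//]; split => // e.
  by rewrite e eqxx in hc0.
have [hv|hv] := leP (dot v h) (dot v c).
  exists c; first by rewrite inE ct orbT.
  by move=> x; rewrite inE => /predU1P[->|/cP//].
exists h; first by rewrite mem_head.
move=> x; rewrite inE => /predU1P[->|xt]; first by rewrite crossvv.
have [cx cx0] := cP x xt; have := dot_cross3 v h c x.
rewrite (crossC h c) hc0 oppr0 mulr0 addr0 => e.
split; first by rewrite -(pmulr_rge0 _ (vt c ct)) e mulr_ge0 // ltW.
move=> hx; apply: (le_trans _ (ltW hv)); apply: cx0; apply/eqP.
by move/eqP: e; rewrite hx mulr0 eq_sym mulf_eq0 gt_eqF.
Qed.

(** Seen from the vertex [b], the other points lie in the open half-plane given by [v], and the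
    extreme direction there leads to [c]. *)
Lemma lattice_vertex_next b x0 : lattice_vertex b -> x0 \in s -> x0 != b ->
  exists c, lattice_vertex c /\ directed_edge b c.
Proof.
move=> [bs [v vmin]] x0s x0b.
pose t := [seq x - b | x <- s & x != b].
have tP x : x \in s -> x != b -> x - b \in t.
  by move=> xs xb; apply: map_f; rewrite mem_filter xb.
have [||e et eP] := @extreme_direction v t.
- by have := tP _ x0s x0b; case: (t).
- move=> _ /mapP[x + ->]; rewrite mem_filter => /andP[xb xs].
  by rewrite dotBr subr_gt0 vmin.
have [c cP ec] := mapP et; move: cP; rewrite mem_filter => /andP[cb cs].
have ve : 0 < dot v e by rewrite ec dotBr subr_gt0 vmin.
have edgeP x : x \in s -> 0 <= cross e (x - b).
  move=> xs; have [->|xb] := eqVneq x b; first by rewrite subrr cross0r.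
  by have [] := eP _ (tP x xs xb).
have e0 : e != 0 by apply: contraTneq ve => ->; rewrite /dot !mxE; clear; lia.
have vle x : x \in s -> cross e (x - b) = 0 -> dot v (x - b) <= dot v e.
  move=> xs; have [-> _|xb] := eqVneq x b.
    by apply: ltW; rewrite subrr /dot !mxE !mulr0 addr0.
  by have [] := eP _ (tP x xs xb).
have vge x : x \in s -> 0 <= dot v (x - b).
  move=> xs; have [->|xb] := eqVneq x b; first by rewrite subrr /dot !mxE !mulr0.
  by rewrite dotBr subr_ge0 ltW // vmin.
exists c; split; last first.
  split=> //; rewrite -?ec //; first by rewrite eq_sym.
  move=> x xs ex0.
  have := cross_dot v e (x - b); rewrite ex0 mul0r subr0 => h1.
  split.
    by rewrite -(pmulr_rge0 _ ve) h1 mulr_ge0 ?vge ?dotvv_ge0.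
  have -> : x - c = (x - b) - e by rewrite ec opprB addrA subrK.
  rewrite dotBr -(pmulr_rle0 _ ve) mulrBr h1 -mulrBl mulr_le0_ge0 ?dotvv_ge0 //.
  by rewrite subr_le0 vle.
have xcE x : x - c = (x - b) - e by rewrite ec opprB addrA subrK.
have vN x : dot (- v) x = - dot v x by rewrite /dot !mxE; ring.
(* The inner normal [rot e] is minimal along the whole edge; [- v] breaks the tie in favour of [c],
   the point of the edge farthest from [b]. *)
apply: (@lattice_vertex_perturb b c (rot e) (- v)) => // x xs.
  by rewrite dot_rot xcE crossBr crossvv subr0 edgeP.
rewrite dot_rot vN xcE crossBr crossvv subr0 => xc ex0.
rewrite dotBr opprB subr_gt0 lt_neqAle vle // andbT.
apply: contraNneq xc => vx.
suff : (x - b) - e = 0 by rewrite -xcE => /eqP; rewrite subr_eq0.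
apply: (cross_dot_eq0 e0); first by rewrite crossBr crossvv subr0.
have := cross_dot v e (x - b); rewrite ex0 mul0r subr0 vx => /eqP.
rewrite -subr_eq0 -mulrBr -dotBr mulf_eq0 (gt_eqF ve) => /eqP //.
Qed.

(** Iterating the successor map repeats a point of the finite list, after which the orbit is
    periodic; minimality of the period makes the points of one period distinct. *)
Lemma vertex_cycle x0 x1 : x0 \in s -> x1 \in s -> x0 != x1 ->
  exists (k : nat) (p : nat -> 'rV[int]_2),
  [/\ (0 < k)%N, forall i, lattice_vertex (p i),
      forall i, directed_edge (p i) (p i.+1),
      forall i, p (i + k)%N = p i
    & forall i j, (i < k)%N -> (j < k)%N -> p i = p j -> i = j].
Proof.
move=> x0s x1s x01; have [b0 b0v] := lattice_vertex_exists x0s.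
(* Made total for [choice]: a point that is no vertex is its own dummy successor. *)
have nextP b : exists c, lattice_vertex b -> lattice_vertex c /\ directed_edge b c.
  have [bv|nbv] := pselect (lattice_vertex b); last by exists b.
  have [xb|xb] := eqVneq x0 b.
    have [|c cP] := lattice_vertex_next bv x1s; last by exists c.
    by rewrite -xb eq_sym.
  by have [c cP] := lattice_vertex_next bv x0s xb; exists c.
have [f fP] := choice nextP.
pose q i := iter i f b0.
have qv i : lattice_vertex (q i).
  by elim: i => // i IH; have [] := fP _ IH.
have qe i : directed_edge (q i) (q i.+1) by have [] := fP _ (qv i).
have qs i : q i \in s by have [] := qv i.
have per i j k : q i = q j -> q (i + k)%N = q (j + k)%N.
  by rewrite /q ![(_ + k)%N]addnC !iterD => ->.
pose P k := `[< (0 < k)%N /\ exists i, q (i + k)%N = q i >].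
have exP : exists k, P k.
  have /injectivePn [i [j nij qij]] :
      ~~ injectiveb (fun i : 'I_(size s).+1 => q i).
    apply/negP => /injectiveP inj.
    have /uniq_leq_size : uniq [seq q (val i) | i <- enum 'I_(size s).+1].
      by rewrite map_inj_uniq ?enum_uniq.
    move=> /(_ s); rewrite size_map size_enum_ord ltnn => H.
    by apply: notF; apply: H => _ /mapP[i _ ->].
  wlog ij : i j nij qij / (i < j)%N.
    move=> H; have [lt|gt|/val_inj e] := ltngtP i j; first exact: H lt.
    - by apply: H gt; rewrite 1?eq_sym.
    - by rewrite e eqxx in nij.
  exists (j - i)%N; apply/asboolP; rewrite subn_gt0; split => //.
  by exists i; rewrite subnKC // ltnW.
case: (ex_minnP exP) => k /asboolP[k0 [i0 qk]] kmin.
exists k, (fun i => q (i0 + i)%N); split => // [i|i|i j ik jk pij].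
- by rewrite addnS.
- by rewrite addnCA (addnC i); apply: per.
wlog ij : i j ik jk pij / (i < j)%N.
  move=> H; have [lt|gt|//] := ltngtP i j; first exact: H lt.
  by apply/esym; apply: H gt.
have /kmin : P (j - i)%N.
  apply/asboolP; rewrite subn_gt0; split => //.
  by exists (i0 + i)%N; rewrite -addnA subnKC // ltnW.
by rewrite leqNgt (leq_ltn_trans (leq_subr _ _) jk).
Qed.

(** If the cross product vanished, [c - b] would point back along the first edge, so all of [s]
    would lie on both sides of one line and thus on it, against the first hypothesis. *)
Lemma consecutive_edges_gt0 a b c :
  (forall u, u != 0 -> exists2 x, x \in s & cross u (x - b) != 0) ->
  directed_edge a b -> directed_edge b c -> 0 < cross (b - a) (c - b).
Proof.
move=> nc [as_ bs ab abP abP0] [_ cs bc bcP _].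
have u0 : b - a != 0 by rewrite subr_eq0 eq_sym.
have abE x : cross (b - a) (x - a) = cross (b - a) (x - b).
  by rewrite -[x - a](subrKA b) crossDr crossvv addr0.
have := abP c cs; rewrite abE le_eqVlt => /predU1P[/esym uw|//].
have [_ duw] := abP0 c cs (etrans (abE c) uw).
have [|x xs] := nc (c - b); first by rewrite subr_eq0 eq_sym.
move=> /eqP[]; apply/eqP; rewrite eq_le bcP // andbT.
rewrite -(pmulr_rle0 _ (dotvv_gt0 u0)) dot_cross uw mul0r subr0.
by rewrite mulr_le0_ge0 // -abE abP.
Qed.

(** The form [cross e] is a nonnegative combination of [cross u] and [cross w], so [b] minimises it
    over [s], as [a'] and [b'] do. Both endpoints then lie on each of the two edge lines whose
    coefficient is positive. *)
Lemma edge_not_between a b c a' b' :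
  directed_edge a b -> directed_edge b c -> directed_edge a' b' ->
  0 < cross (b - a) (c - b) ->
  0 <= cross (b - a) (b' - a') -> 0 <= cross (b' - a') (c - b) ->
  a' = b \/ b' = b.
Proof.
move=> [_ bs ab abP abP0] [_ _ bc bcP bcP0] [a's b's ab' abP' abP0'].
set u := b - a in abP abP0 *; set w := c - b in bcP bcP0 *.
set e := b' - a' in abP' abP0' *.
move=> d0 be0 al0.
have u0 : u != 0 by rewrite subr_eq0 eq_sym.
have w0 : w != 0 by rewrite subr_eq0 eq_sym.
have e0 : e != 0 by rewrite subr_eq0 eq_sym.
have dE := cross_pluckerv u e w.
have abE x : cross u (x - a) = cross u (x - b).
  by rewrite -[x - a](subrKA b) crossDr crossvv addr0.
have abE' x : cross e (x - a') = cross e (x - b').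
  by rewrite -[x - a'](subrKA b') crossDr crossvv addr0.
have hE x : cross u w * cross e (x - b) =
    cross e w * cross u (x - b) + cross u e * cross w (x - b).
  by rewrite -crossZl dE crossDl !crossZl.
have t1 x : x \in s -> 0 <= cross e w * cross u (x - b).
  by move=> xs; rewrite mulr_ge0 // -abE abP.
have t2 x : x \in s -> 0 <= cross u e * cross w (x - b).
  by move=> xs; rewrite mulr_ge0 // bcP.
have vanish x : x \in s -> cross e (x - b) <= 0 ->
   cross e w * cross u (x - b) = 0 /\ cross u e * cross w (x - b) = 0.
  move=> xs xb; have : cross u w * cross e (x - b) <= 0.
    by rewrite pmulr_rle0.
  rewrite hE; move: (t1 x xs) (t2 x xs); clear; lia.
have ea : cross e (a' - b) <= 0.
  by have := abP' b bs; rewrite crossBr [cross e (a' - b)]crossBr; clear; lia.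
have eb : cross e (b' - b) <= 0.
  have := abP' b bs; rewrite abE' crossBr [cross e (b' - b)]crossBr.
  by clear; lia.
have [a1 a2] := vanish _ a's ea; have [b1 b2] := vanish _ b's eb.
(* Here [e] is parallel to [w]; the two edges share a line and a direction, hence their starting
   point. *)
have [al|al] := eqVneq (cross e w) 0.
  have be : cross u e != 0.
    apply: contraNneq e0 => be; apply/eqP/(scalez_eq0 (lt0r_neq0 d0)).
    by rewrite dE al be !scale0r addr0.
  left; move: a2 => /eqP; rewrite mulf_eq0 (negbTE be) /= => /eqP a2.
  have [dw _] := bcP0 a' a's a2.
  have ebz : cross e (b - a') = 0.
    have : cross u w * cross e (a' - b) = 0 by rewrite hE al a2; ring.
    move=> /eqP; rewrite mulf_eq0 gt_eqF //= => /eqP.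
    by rewrite crossBr [cross e (b - a')]crossBr; clear; lia.
  have [de _] := abP0' b bs ebz.
  suff : a' - b = 0 by move=> /eqP; rewrite subr_eq0 => /eqP.
  apply: (cross_dot_eq0 w0 a2); apply/eqP; rewrite eq_le dw andbT.
  have be0' : 0 < cross u e by rewrite lt_neqAle eq_sym be be0.
  rewrite -(pmulr_rle0 _ be0') -dotZl.
  have <- : cross u w *: e = cross u e *: w by rewrite dE al scale0r add0r.
  rewrite dotZl pmulr_rle0 //.
  by move: de; rewrite dotBr [dot e (a' - b)]dotBr; clear; lia.
have al' : 0 < cross e w by rewrite lt_neqAle eq_sym al al0.
(* With both coefficients positive, [a'] lies on both lines and equals [b]; if [e] is parallel to
   [u], the two edges share their end point. *)
have [be|be] := eqVneq (cross u e) 0; last first.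
  left; move: a1 a2 => /eqP; rewrite mulf_eq0 (negbTE al) /= => /eqP a1.
  move=> /eqP; rewrite mulf_eq0 (negbTE be) /= => /eqP a2.
  suff : a' - b = 0 by move=> /eqP; rewrite subr_eq0 => /eqP.
  by apply: cross_cross_eq0 a1 a2; rewrite gt_eqF.
right; move: b1 => /eqP; rewrite mulf_eq0 (negbTE al) /= => /eqP b1.
have [_ du] := abP0 b' b's (etrans (abE b') b1).
have ebz : cross e (b - a') = 0.
  have : cross u w * cross e (b' - b) = 0 by rewrite hE be b1; ring.
  move=> /eqP; rewrite mulf_eq0 gt_eqF //= => /eqP.
  by rewrite abE' crossBr [cross e (b - b')]crossBr; clear; lia.
have [_ de] := abP0' b bs ebz.
suff : b' - b = 0 by move=> /eqP; rewrite subr_eq0 => /eqP.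
apply: (cross_dot_eq0 u0 b1); apply/eqP; rewrite eq_le du /=.
rewrite -(pmulr_rge0 _ al') -dotZl.
have <- : cross u w *: e = cross e w *: u by rewrite dE be scale0r addr0.
rewrite dotZl pmulr_rge0 //.
by move: de; rewrite dotBr [dot e (b' - b)]dotBr; clear; lia.
Qed.

End Polygon.

(** * The edge vectors of a boundary cycle *)

Section Cycle.
Variables (s : seq 'rV[int]_2) (k : nat) (p : nat -> 'rV[int]_2) (D : int).
Hypotheses (k_gt0 : (0 < k)%N)
  (p_edge : forall i, directed_edge s (p i) (p i.+1))
  (p_per : forall i, p (i + k)%N = p i)
  (p_inj : forall i j, (i < k)%N -> (j < k)%N -> p i = p j -> i = j).
Let E i := p i.+1 - p i.
Hypotheses (E_gt0 : forall i, 0 < cross (E i) (E i.+1))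
  (E_le : forall i, cross (E i) (E i.+1) <= D).

Let p_mod i : p (i %% k) = p i.
Proof.
rewrite [in RHS](divn_eq i k); elim: (i %/ k)%N => [|m IH].
  by rewrite mul0n add0n.
by rewrite mulSn -addnA addnC p_per.
Qed.

Let E_mod i : E (i %% k) = E i.
Proof.
rewrite /E p_mod -(p_mod (i %% k).+1) -(p_mod i.+1).
by have -> : ((i %% k).+1 = i.+1 %[mod k])%N by rewrite -addn1 modnDml addn1.
Qed.

Let sum_E : \sum_(i < k) E i = 0.
Proof.
rewrite -(big_mkord xpredT E) telescope_sumr //.
by rewrite -(p_per 0) add0n subrr.
Qed.

(** An edge in the closed sector of two consecutive edges would start or end at their common vertex
    and so be one of them. *)
Let succ_rayE (i j : 'I_k) : E j = E i.+1 -> j = (i.+1 %% k)%N :> nat ->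
  succ_ray [set: 'I_k] (fun i => E (val i)) i j.
Proof.
move=> Ej ej; split; rewrite ?inE // ?Ej //= => c _ ci cj.
rewrite ?Ej; have [h1|h1] := ltP (cross (E i) (E c)) 0; first by left.
have [h2|h2] := ltP (cross (E c) (E i.+1)) 0; first by right.
have [] := edge_not_between (p_edge i) (p_edge i.+1) (p_edge c) (E_gt0 i) _ h2.
- exact: h1.
- rewrite -(p_mod i.+1) => /p_inj; rewrite ltn_pmod // => /(_ _ isT) e.
  by case/eqP: cj; apply: val_inj; rewrite /= ej e.
- rewrite -(p_mod i.+1) -(p_mod c.+1) => /p_inj; rewrite !ltn_pmod //.
  move=> /(_ isT isT) /eqP; rewrite -(addn1 c) -(addn1 i) eqn_modDr.
  rewrite !modn_small //.
  by move=> e; case/eqP: ci; apply: val_inj; apply/eqP.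
Qed.

Lemma cycle_fan : fan D [set: 'I_k] (fun i => E (val i)).
Proof.
split.
- by under eq_bigl do rewrite inE.
- move=> a _; pose b := Ordinal (ltn_pmod a.+1 k_gt0).
  have Eb : E b = E a.+1 := E_mod _.
  by exists b; split; [exact: succ_rayE | rewrite Eb].
(* Adding [k.-1] modulo [k] gives the cyclic predecessor without truncated subtraction. *)
- move=> b _; pose a := Ordinal (ltn_pmod (b + k.-1) k_gt0).
  have ab : b = (a.+1 %% k)%N :> nat.
    by rewrite /= -addn1 modnDml addn1 -addnS prednK // modnDr modn_small.
  have Eb : E b = E a.+1 by rewrite ab E_mod.
  by exists a; split; [exact: succ_rayE | rewrite Eb].
Qed.

(** Each nonnegative term is at most the sum over all edges. As the edges sum to zero, [x] may be
    replaced there by [p 0], and each of the [k] terms then involves a path of fewer than [k]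
    edges. *)
Lemma cycle_box (F : int) x i : x \in s ->
  (forall a b : 'I_k, `|cross (E a) (E b)| <= F) ->
  0 <= cross (E i) (x - p i) <= k%:Z * k%:Z * F.
Proof.
move=> xs HF.
have pos j : 0 <= cross (E j) (x - p j).
  by have [_ _ _ + _] := p_edge j; apply.
have F0 : 0 <= F by apply: le_trans (HF (Ordinal k_gt0) (Ordinal k_gt0)).
rewrite pos /= -(E_mod i) -(p_mod i).
pose i' := Ordinal (ltn_pmod i k_gt0).
have path j : p j - p 0%N = \sum_(0 <= l < j) E l.
  by rewrite telescope_sumr.
apply: (@le_trans _ _ (\sum_(j < k) cross (E j) (x - p j))).
  by rewrite (bigD1 i') //= lerDl sumr_ge0.
have -> : \sum_(j < k) cross (E j) (x - p j) =
    - \sum_(j < k) cross (E j) (p j - p 0%N).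
  rewrite -sumrN; transitivity (\sum_(j < k)
    (- cross (x - p 0%N) (E j) - cross (E j) (p j - p 0%N))).
    apply: eq_bigr => j _; rewrite (crossC (x - _)) opprK -crossBr.
    by rewrite opprB addrA subrK.
  by rewrite big_split /= sumrN -cross_sumr sum_E cross0r oppr0 add0r.
rewrite -sumrN.
have le1 (j : 'I_k) : - cross (E j) (p j - p 0%N) <= k%:Z * F.
  rewrite path cross_sumr -sumrN.
  apply: (@le_trans _ _ (\sum_(0 <= l < j) F)).
    rewrite big_nat [X in _ <= X]big_nat.
    apply: ler_sum => l /andP[_ lj]; have lk := ltn_trans lj (ltn_ord j).
    by have := HF j (Ordinal lk) => /=; clear; lia.
  rewrite sumr_const_nat subn0 -mulr_natl ler_wpM2r //.
  by rewrite natz lez_nat ltnW.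
apply: (le_trans (ler_sum _ (fun j _ => le1 j))).
by rewrite sumr_const card_ord -mulr_natl natz mulrA.
Qed.

End Cycle.

(** * Convex hulls and primitive vectors *)

(** The linear form [cross u], which is the inner normal of an edge with the polygon on its left. *)
Definition conormal (K : comNzRingType) (u : 'rV[K]_2) : 'cV[K]_2 :=
  \col_i (if i == 0 then - u 0 1 else u 0 0).

Section Real.
Variable R : realType.
Implicit Types (x y : 'rV[R]_2) (v : 'cV[R]_2) (A P : set 'rV[R]_2).

Lemma pairingE x v : pairing x v = x 0 0 * v 0 0 + x 0 1 * v 1 0.
Proof.
rewrite /pairing mxE !big_ord_recl big_ord0 addr0.
by congr (_ * _ + x 0 _ * v _ _); apply: val_inj.
Qed.

Lemma pairingDl x y v : pairing (x + y) v = pairing x v + pairing y v.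
Proof. by rewrite /pairing mulmxDl mxE. Qed.

Lemma pairingBl x y v : pairing (x - y) v = pairing x v - pairing y v.
Proof. rewrite !pairingE !mxE; ring. Qed.

Lemma pairingZl a x v : pairing (a *: x) v = a * pairing x v.
Proof. by rewrite /pairing -scalemxAl mxE. Qed.

Lemma pairing_suml I (r : seq I) (F : I -> 'rV[R]_2) v :
  pairing (\sum_(i <- r) F i) v = \sum_(i <- r) pairing (F i) v.
Proof.
apply: (big_morph (fun x => pairing x v)) => [x y|]; first exact: pairingDl.
by rewrite pairingE !mxE !mul0r addr0.
Qed.

Lemma pairing_conormal (u x : 'rV[R]_2) : pairing x (conormal u) = cross u x.
Proof. rewrite pairingE !mxE /= /cross; ring. Qed.

Lemma pairing_tr (u x : 'rV[R]_2) : pairing x u^T = dot u x.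
Proof. rewrite pairingE !mxE /= /dot; ring. Qed.

Lemma cross_realify (u v : 'rV[int]_2) :
  cross (realify R u) (realify R v) = (cross u v)%:~R.
Proof. by rewrite /cross !mxE rmorphB !rmorphM. Qed.

Lemma dot_realify (u v : 'rV[int]_2) :
  dot (realify R u) (realify R v) = (dot u v)%:~R.
Proof. by rewrite /dot !mxE rmorphD !rmorphM. Qed.

Lemma realifyB p q (u v : 'M[int]_(p, q)) :
  realify R (u - v) = realify R u - realify R v.
Proof. exact: map_mxB. Qed.

Lemma realifyD p q (u v : 'M[int]_(p, q)) :
  realify R (u + v) = realify R u + realify R v.
Proof. exact: map_mxD. Qed.

Lemma realifyZ p q (a : int) (u : 'M[int]_(p, q)) :
  realify R (a *: u) = a%:~R *: realify R u.
Proof. exact: map_mxZ. Qed.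

Lemma realify_inj p q : injective (@realify R p q).
Proof.
move=> u v /matrixP uv; apply/matrixP => i j; have := uv i j.
by rewrite !mxE => /intr_inj.
Qed.

Lemma conormal_realify (u : 'rV[int]_2) :
  realify R (conormal u) = conormal (realify R u).
Proof. by apply/matrixP => i j; rewrite !mxE; case: ifP; rewrite ?rmorphN. Qed.

Lemma sub_conv_hull A : A `<=` conv_hull A.
Proof.
move=> x Ax; exists 1%N, (fun=> x), (fun=> 1); split => //.
  by rewrite big_ord1.
by rewrite big_ord1 scale1r.
Qed.

Lemma conv_hull_ge A v t : (forall x, A x -> t <= pairing x v) ->
  forall x, conv_hull A x -> t <= pairing x v.
Proof.
move=> H x [k [p [w [Ap w0 w1 ->]]]]; rewrite pairing_suml.
rewrite -[t]mul1r -w1 mulr_suml; apply: ler_sum => i _.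
by rewrite pairingZl ler_wpM2l // H.
Qed.

Lemma conv_hull_segment A x y t : A x -> A y -> 0 <= t <= 1 ->
  conv_hull A (x + t *: (y - x)).
Proof.
move=> Ax Ay /andP[t0 t1].
exists 2%N, (fun i => if i == 0 then x else y),
  (fun i => if i == 0 then 1 - t else t); split.
- by move=> i; case: ifP.
- by move=> i; case: ifP; rewrite ?subr_ge0.
- by rewrite !big_ord_recl big_ord0 /= addr0 subrK.
- rewrite !big_ord_recl big_ord0 /= addr0.
  by apply/rowP => i; rewrite !mxE; ring.
Qed.

(** The gap of a point over [b] is the weighted mean of the gaps of its generators and vanishes only
    if all weight lies on [b]. *)
Lemma strict_min_vertex A b v : A b ->
  (forall x, A x -> x <> b -> pairing b v < pairing x v) ->
  is_vertex (conv_hull A) b.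
Proof.
move=> Ab bmin; split; first exact: sub_conv_hull.
exists v => x [k [p [w [Ap w0 w1 ->]]]] xb.
have le_p i : pairing b v <= pairing (p i) v.
  have [->//|pb] := eqVneq (p i) b; apply/ltW/bmin => //; exact/eqP.
have sumE : pairing (\sum_(i < k) w i *: p i) v - pairing b v =
    \sum_(i < k) w i * (pairing (p i) v - pairing b v).
  under [RHS]eq_bigr do rewrite mulrBr.
  rewrite sumrB -mulr_suml w1 mul1r pairing_suml; congr (_ - _).
  by apply: eq_bigr => i _; rewrite pairingZl.
rewrite -subr_gt0 sumE lt_neqAle sumr_ge0 => [|i _]; last first.
  by rewrite mulr_ge0 ?subr_ge0.
rewrite andbT eq_sym; apply/negP.
rewrite psumr_eq0 => [/allP H|i _]; last by rewrite mulr_ge0 ?subr_ge0.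
apply: xb; transitivity (\sum_(i < k) w i *: b); last first.
  by rewrite -scaler_suml w1 scale1r.
apply: eq_bigr => i _; have := H i (mem_index_enum i).
rewrite /= mulf_eq0 => /orP[/eqP->|]; first by rewrite !scale0r.
rewrite subr_eq0 => /eqP e; have [->//|/eqP pb] := eqVneq (p i) b.
by have := bmin _ (Ap i) pb; rewrite e ltxx.
Qed.

Lemma vertex_in_generators A x : is_vertex (conv_hull A) x -> A x.
Proof.
move=> [[k [p [w [Ap w0 w1 xE]]]] [v vmin]]; apply: contrapT => nAx.
have pgt i : pairing x v < pairing (p i) v.
  apply: vmin; first exact: sub_conv_hull.
  by move=> e; apply: nAx; rewrite -e.
have : 0 < \sum_(i < k) w i * (pairing (p i) v - pairing x v).
  have [i wi] : exists i, w i != 0.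
    apply: contrapT => none; have : \sum_(i < k) w i = 0.
      apply: big1 => i _; apply/eqP/negPn/negP => wi; apply: none; by exists i.
    by rewrite w1 => /eqP; rewrite oner_eq0.
  rewrite (bigD1 i) //=; apply: ltr_pwDl.
    by rewrite mulr_gt0 ?subr_gt0 // lt_neqAle eq_sym wi w0.
  by apply: sumr_ge0 => j _; rewrite mulr_ge0 // subr_ge0 ltW.
under eq_bigr do rewrite mulrBr; rewrite sumrB -mulr_suml w1 mul1r.
have -> : \sum_(i < k) w i * pairing (p i) v = pairing x v.
  by rewrite xE pairing_suml; apply: eq_bigr => i _; rewrite pairingZl.
by rewrite subrr ltxx.
Qed.

Lemma min_not_interior P x (u : 'rV[R]_2) : u != 0 ->
  (forall y, P y -> cross u x <= cross u y) -> ~ interior P x.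
Proof.
move=> u0 xmin /nbhs_ballP[e /= e0 eP].
pose h := rot u.
have ch : 0 < cross u h by rewrite cross_rot dotvv_gt0.
(* The step [- d *: h] has norm at most [e / 2] and lowers [cross u]. *)
pose d := e / 2 / (1 + `|h|).
have h1 : 0 < 1 + `|h| by rewrite ltr_pwDl.
have d0 : 0 < d by rewrite !divr_gt0.
have /eP/xmin : ball x e (x - d *: h).
  rewrite -ball_normE /ball_ /= opprB addrC subrK normrZ gtr0_norm //.
  apply: (@le_lt_trans _ _ (e / 2)); last by rewrite gtr_pMr // invf_lt1 // ltr1n.
  rewrite /d mulrAC ler_pdivrMr // ler_wpM2l ?divr_ge0 ?(ltW e0) //.
  by rewrite lerDr.
rewrite crossBr crossZr => H.
have := mulr_gt0 d0 ch.
by rewrite ltNge -subr_ge0 sub0r; move: H; rewrite lerDl => ->.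
Qed.

Lemma card_le_I_bound (A : set 'rV[R]_2) n k (g : nat -> 'rV[R]_2) :
  A #<= `I_n -> (forall i, (i < k)%N -> A (g i)) ->
  (forall i j, (i < k)%N -> (j < k)%N -> g i = g j -> i = j) -> (k <= n)%N.
Proof.
move=> An gA ginj; rewrite -card_le_II.
have /card_le_eql <- : g @` `I_k #= `I_k.
  by apply: inj_card_eq => i j; rewrite !inE => ik jk; apply: ginj.
apply: card_le_trans An; apply: subset_card_le => _ [i /= ik <-].
exact: gA.
Qed.

(** Ensures that the [xget] in [mult] returns a true maximum and not its default value. *)
Lemma finite_nat_max (M : set nat) N : M !=set0 -> (forall d, M d -> (d <= N)%N) ->
  forall d, M d -> (d <= xget 0%N (M `&` ubound M))%N.
Proof.
move=> [d0 Md0] MN.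
have ex : exists d, `[< M d >] by exists d0; apply/asboolP.
have ub d : `[< M d >] -> (d <= N)%N by move=> /asboolP /MN.
case: (ex_maxnP ex ub) => mx /asboolP Mmx mxP d Md.
have [_ H] : (M `&` ubound M) (xget 0%N (M `&` ubound M)).
  by apply: xgetPex; exists mx; split => // e /asboolP /mxP.
exact: H.
Qed.

End Real.

Section Primitive.
Implicit Types (u : 'rV[int]_2) (v : 'cV[int]_2).

Lemma primitive_bezout v : primitive v ->
  exists a b : int, a * v 0 0 + b * v 1 0 = 1.
Proof.
move=> [v0 vprim]; pose g := gcdz (v 0 0) (v 1 0).
have vE : v = g *: \col_(i < 2) (if i == 0 then divz (v 0 0) g else divz (v 1 0) g).
  apply/matrixP => i j; rewrite !mxE (ord1 j).
  have [->|->] := ord2P i.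
  - by rewrite /= mulrC divzK // dvdz_gcdl.
  - by rewrite /= mulrC divzK // dvdz_gcdr.
have g1 := vprim _ _ vE.
have [a [b ab]] := Bezoutz (v 0 0) (v 1 0).
exists a, b; rewrite ab -/g -g1 ger0_norm //.
Qed.

Lemma bezout_primitive v (a b : int) : a * v 0 0 + b * v 1 0 = 1 -> primitive v.
Proof.
move=> ab; split=> [v0|k w vE]; first by move: ab; rewrite v0 !mxE; clear; lia.
move: ab; rewrite vE !mxE => ab.
have : `|k| * `|a * w 0 0 + b * w 1 0| = 1.
  by rewrite -normrM -[RHS]normr1 -ab; congr `|_|; ring.
move: (a * _ + _) => z; clear.
have : `|z| = 0 \/ 1 <= `|z| by lia.
case=> [->|z1 e]; first by rewrite mulr0; lia.
have : 1 <= `|k| by lia.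
by have := ler_peMr (normr_ge0 k) z1; rewrite e; lia.
Qed.

Lemma primitive_direction u : u != 0 -> exists (l : int) u',
  [/\ 0 < l, u = l *: u' & primitive (conormal u')].
Proof.
move=> u0; pose g := gcdz (u 0 0) (u 0 1).
have g0 : 0 < g.
  rewrite lt_neqAle eq_sym gcdz_eq0 andbT.
  by apply: contra u0 => /andP[/eqP a /eqP b]; apply/eqP/row2P; rewrite mxE.
pose u' : 'rV[int]_2 := \row_i divz (u 0 i) g.
have uE : u = g *: u'.
  by apply: row2P; rewrite !mxE mulrC divzK // (dvdz_gcdl, dvdz_gcdr).
exists g, u'; split => //.
have [a [b ab]] := Bezoutz (u 0 0) (u 0 1).
apply: (@bezout_primitive _ (- b) a).
apply: (mulfI (lt0r_neq0 g0)); rewrite mulr1.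
transitivity (a * u 0 0 + b * u 0 1); last exact: ab.
rewrite [in RHS]uE !mxE /=; ring.
Qed.

(** The multiplier is the cross product of [u] with a Bézout row [(a, b)] for [v]. *)
Lemma primitive_annihilator u v : primitive v ->
  u 0 0 * v 0 0 + u 0 1 * v 1 0 = 0 ->
  exists l : int, u = l *: \row_j (if j == 0 then v 1 0 else - v 0 0).
Proof.
move=> /primitive_bezout[a [b ab]] uv.
exists (b * u 0 0 - a * u 0 1); apply: row2P; rewrite !mxE /=.
  transitivity (u 0 0 * (a * v 0 0 + b * v 1 0)
    - a * (u 0 0 * v 0 0 + u 0 1 * v 1 0)); last by ring.
  by rewrite ab uv; ring.
transitivity (u 0 1 * (a * v 0 0 + b * v 1 0)
  - b * (u 0 0 * v 0 0 + u 0 1 * v 1 0)); last by ring.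
by rewrite ab uv; ring.
Qed.

Lemma det2 (A : 'M[int]_2) : \det A = A 0 0 * A 1 1 - A 0 1 * A 1 0.
Proof.
rewrite (expand_det_row _ 0) !big_ord_recl big_ord0 /cofactor !det_mx11 !mxE.
have e0 : lift 0 0 = 1 :> 'I_2 by apply: val_inj.
have e1 : lift 1 0 = 0 :> 'I_2 by apply: val_inj.
have e2 : (ord0 : 'I_2) = 0 by apply: val_inj.
have e3 : (ord0 : 'I_1) = 0 by apply: val_inj.
rewrite ?e2 ?e3 ?e0 ?e1 /= expr0 expr1; ring.
Qed.

Lemma det_row_mx2 (v1 v2 : 'cV[int]_2) :
  \det (row_mx v1 v2 : 'M[int]_2) = v1 0 0 * v2 1 0 - v1 1 0 * v2 0 0.
Proof.
have e0 : (0 : 'I_2) = @lshift 1 1 0 by apply: val_inj.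
have e1 : (1 : 'I_2) = @rshift 1 1 0 by apply: val_inj.
have M0 i : (row_mx v1 v2 : 'M[int]_2) i 0 = v1 i 0.
  by rewrite -(row_mxEl v1 v2) -e0.
have M1 i : (row_mx v1 v2 : 'M[int]_2) i 1 = v2 i 0.
  by rewrite -(row_mxEr v1 v2) -e1.
by rewrite det2 !M0 !M1; ring.
Qed.

End Primitive.

(** * Corners and edges of a lattice polygon *)

Section Geometry.
Variables (R : realType) (s : seq 'rV[int]_2).
Let A : set 'rV[R]_2 := realify R @` [set` s].
Let P : set 'rV[R]_2 := conv_hull A.

Let PA x : x \in s -> P (realify R x).
Proof. by move=> xs; apply: sub_conv_hull; exists x. Qed.

Let cross_ge (u : 'rV[R]_2) t : (forall x, x \in s -> t <= cross u (realify R x)) ->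
  forall y, P y -> t <= cross u y.
Proof.
move=> H y; rewrite -pairing_conormal; apply: conv_hull_ge => _ [x xs <-].
by rewrite pairing_conormal H.
Qed.

Lemma realify_neq0 (u : 'rV[int]_2) : u != 0 -> realify R u != 0.
Proof.
apply: contraNneq => e; apply/eqP/(@realify_inj R); rewrite e.
by apply/matrixP => i j; rewrite !mxE.
Qed.

(** Otherwise [cross u] would be constant on [s], on its hull and on the affine hull, which contains
    [b + rot u]. *)
Lemma two_dimensional_noncollinear (u b : 'rV[int]_2) : two_dimensional P ->
  u != 0 -> exists2 x, x \in s & cross u (x - b) != 0.
Proof.
move=> Pdim u0; apply: contrapT => none.
pose ur := realify R u; pose c := cross ur (realify R b).
have sc x : x \in s -> cross ur (realify R x) = c.
  move=> xs; rewrite /c !cross_realify; congr (_%:~R).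
  apply/eqP; rewrite -subr_eq0 -crossBr; apply/negPn/negP => nz.
  by apply: none; exists x.
have Pc y : P y -> cross ur y = c.
  move=> Py; apply/eqP; rewrite eq_le; apply/andP; split; last first.
    by apply: cross_ge Py => x /sc->.
  have : - c <= cross (-1 *: ur) y.
    by apply: cross_ge Py => x /sc xc; rewrite crossZl xc mulN1r.
  by rewrite crossZl mulN1r lerN2.
pose h := rot ur.
have : affine_hull P (realify R b + h) by rewrite Pdim.
move=> [k [p [w [Pp w1 e]]]].
have : cross ur (realify R b + h) = c.
  rewrite e cross_sumr -[RHS]mul1r -w1 mulr_suml.
  by apply: eq_bigr => i _; rewrite crossZr Pc.
rewrite crossDr -/c => /eqP; rewrite -subr_eq0 addrC addKr.
by rewrite cross_rot gt_eqF // dotvv_gt0 // realify_neq0.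
Qed.

Lemma lattice_vertex_is_vertex b : lattice_vertex s b -> is_vertex P (realify R b).
Proof.
move=> [bs [v vmin]]; apply: (@strict_min_vertex _ _ _ (realify R v)^T).
  by exists b.
move=> _ [x xs <-] xb; rewrite !pairing_tr !dot_realify ltr_int vmin //.
by apply: contra_not_neq xb => ->.
Qed.

Lemma cone_mult_le_mult b : lattice_vertex s b ->
  (cone_mult (normal_cone P (realify R b)) <= mult P)%N.
Proof.
move=> /lattice_vertex_is_vertex bv.
(* All vertices come from [s], so the sum over [s] bounds the multiplicities. *)
apply: (@finite_nat_max _
  (\sum_(x <- s) cone_mult (normal_cone P (realify R x)))%N).
- by exists (cone_mult (normal_cone P (realify R b))); exists (realify R b).
- move=> _ [_ /vertex_in_generators[x xs <-] <-].
  by rewrite (big_rem x) //= leq_addr.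
- by exists (realify R b).
Qed.

Lemma edge_boundary b c t : directed_edge s b c -> 0 <= t <= 1 ->
  boundary P (realify R b + t *: (realify R c - realify R b)).
Proof.
move=> [bs cs bc bP _] t01.
have Px : P (realify R b + t *: (realify R c - realify R b)).
  by apply: conv_hull_segment => //; [exists b | exists c].
split; first exact: subset_closure.
apply: (@min_not_interior _ _ _ (realify R (c - b))).
  by rewrite realify_neq0 // subr_eq0 eq_sym.
move=> y; rewrite -realifyB crossDr crossZr crossvv mulr0 addr0.
apply: cross_ge => x xs; rewrite !cross_realify ler_int -subr_ge0 -crossBr.
exact: bP.
Qed.

Lemma lattice_vertices_le n k (p : nat -> 'rV[int]_2) :
  (boundary P `&` lattice R) #<= `I_n ->
  (forall i, directed_edge s (p i) (p i.+1)) ->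
  (forall i j, (i < k)%N -> (j < k)%N -> p i = p j -> i = j) -> (k <= n)%N.
Proof.
move=> Pn pe pinj.
apply: (card_le_I_bound (g := fun i => realify R (p i)) Pn).
  move=> i _; split; last by exists (p i).
  rewrite -[realify R (p i)]addr0 -(scale0r (realify R (p i.+1) - realify R (p i))).
  by apply: edge_boundary => //; rewrite lexx ler01.
by move=> i j ik jk /realify_inj; apply: pinj.
Qed.

(** The edge carries the [|l| + 1] lattice points [g t]; the sign of [l] in [g] makes them start at
    [b] for either orientation of [r]. *)
Lemma lattice_length_le n b c (l : int) (r : 'rV[int]_2) :
  (boundary P `&` lattice R) #<= `I_n ->
  directed_edge s b c -> c - b = l *: r -> `|l| <= n%:Z.
Proof.
move=> Pn bc bcE; have [_ _ nbc _ _] := bc.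
have l0 : l != 0.
  by apply: contraNneq nbc => l0; rewrite eq_sym -subr_eq0 bcE l0 scale0r.
have r0 : r != 0.
  by apply: contraNneq nbc => r0; rewrite eq_sym -subr_eq0 bcE r0 scaler0.
rewrite -abszE lez_nat; apply: leq_trans (leqnSn _) _.
pose g t : 'rV[int]_2 := b + (t%:Z * sgz l) *: r.
apply: (card_le_I_bound (g := fun t => realify R (g t)) Pn).
  move=> t; rewrite ltnS => tl; split; last by exists (g t).
  have -> : realify R (g t) =
      realify R b + (t%:R / `|l|%:~R) *: (realify R c - realify R b).
    rewrite -realifyB bcE realifyD !realifyZ scalerA; congr (_ + _ *: _).
    have lr : `|l|%:~R != 0 :> R by rewrite intr_eq0 normr_eq0.
    rewrite rmorphM /= -mulrA; congr (_ * _).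
    by rewrite [in X in _ * X](intEsg l) rmorphM /= mulrCA mulVf // mulr1.
  apply: edge_boundary => //; rewrite divr_ge0 ?ler0n ?ler0z //=.
  rewrite ler_pdivrMr ?ltr0z ?normr_gt0 // mul1r -abszE.
  by rewrite -pmulrn ler_nat.
move=> i j _ _ /realify_inj /addrI /eqP; rewrite -subr_eq0 -scalerBl -mulrBl.
move=> /eqP e; have [//|nij] := eqVneq i j.
have := scalez_eq0 _ e; rewrite mulf_eq0 sgz_eq0 (negbTE l0) orbF.
rewrite subr_eq0 eqz_nat nij => /(_ isT) /eqP; by rewrite (negbTE r0).
Qed.

(** * The normal cone between two consecutive edges *)

Section Corner.
Variables a b c : 'rV[int]_2.
Hypotheses (ab : directed_edge s a b) (bc : directed_edge s b c).
Let u := b - a.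
Let w := c - b.
Hypothesis uw : 0 < cross u w.

(** By Cramer's rule [y - b] is a nonnegative combination of [- u] and [w], so the two neighbours of
    [b] decide. *)
Let normal_coneP v : normal_cone P (realify R b) v <->
  0 <= pairing (realify R w) v /\ pairing (realify R u) v <= 0.
Proof.
have [as_ bs _ abP _] := ab; have [_ cs _ bcP _] := bc.
split=> [H|[wv uv] y Py].
  split; first by rewrite realifyB; apply: H; exact: PA.
  rewrite realifyB pairingBl subr_le0 -subr_ge0 -pairingBl; apply: H.
  exact: PA.
have d0 : 0 < (cross u w)%:~R :> R by rewrite ltr0z.
rewrite -(pmulr_rge0 _ d0) -pairingZl -cross_realify cross_pluckerv.
rewrite pairingDl !pairingZl.
have yb1 : 0 <= cross (realify R u) (y - realify R b).
  rewrite crossBr subr_ge0; apply: cross_ge Py => x xs.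
  rewrite !cross_realify ler_int -subr_ge0 -crossBr.
  have <- : cross u (x - a) = cross u (x - b).
    by rewrite -[x - a](subrKA b) crossDr crossvv addr0.
  exact: abP.
have yb2 : 0 <= cross (realify R w) (y - realify R b).
  rewrite crossBr subr_ge0; apply: cross_ge Py => x xs.
  by rewrite !cross_realify ler_int -subr_ge0 -crossBr bcP.
rewrite (crossC _ (realify R w)) mulNr addr_ge0 // ?oppr_ge0 ?mulr_ge0 //.
by rewrite mulr_ge0_le0.
Qed.

Lemma corner_primitive_generators : exists v1 v2,
  primitive_generators (normal_cone P (realify R b)) v1 v2.
Proof.
have u0 : u != 0 by apply: contraTneq uw => ->; rewrite crossC cross0r.
have w0 : w != 0 by apply: contraTneq uw => ->; rewrite cross0r.
have [l [u' [l0 uE pu]]] := primitive_direction u0.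
have [l2 [w' [l20 wE pw]]] := primitive_direction w0.
exists (conormal u'), (conormal w'); split => //.
have uw' : 0 < cross (realify R u') (realify R w').
  rewrite cross_realify ltr0z; move: uw.
  by rewrite uE wE crossZl crossZr !pmulr_rgt0.
apply/seteqP; split => v; last first.
  move=> [x [y [x0 y0 ->]]]; apply/normal_coneP.
  have E z : pairing z (x *: realify R (conormal u') + y *: realify R (conormal w'))
      = x * cross (realify R u') z + y * cross (realify R w') z.
    rewrite -!pairing_conormal -!conormal_realify !pairingE !mxE; ring.
  have lr : 0 <= l%:~R :> R by rewrite ler0z ltW.
  have lr2 : 0 <= l2%:~R :> R by rewrite ler0z ltW.
  rewrite !E uE wE !realifyZ !crossZr !crossvv.
  rewrite (crossC (realify R w')) !mulr0 addr0 add0r; split.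
    by rewrite !mulr_ge0 // ltW.
  by rewrite !mulrN oppr_le0 !mulr_ge0 // ltW.
move=> /normal_coneP[]; rewrite uE wE !realifyZ !pairingZl => wv uv.
have lr : 0 < l%:~R :> R by rewrite ltr0z.
have lr2 : 0 < l2%:~R :> R by rewrite ltr0z.
rewrite pmulr_rge0 // in wv; rewrite pmulr_rle0 // in uv.
set d := cross (realify R u') (realify R w') in uw'.
(* Cramer's rule for [v] in terms of the two conormals. *)
exists (pairing (realify R w') v / d), (- pairing (realify R u') v / d); split.
- by rewrite divr_ge0 // ltW.
- by rewrite divr_ge0 ?oppr_ge0 // ltW.
have d0 : d != 0 by rewrite gt_eqF.
apply: (scalerI d0); rewrite scalerDr !scalerA !(mulrCA d) mulfV // !mulr1.
rewrite !conormal_realify /d.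
apply/matrixP => i j; rewrite (ord1 j) !pairingE.
by have [->|->] := ord2P i; rewrite /cross !mxE /=; ring.
Qed.

(** Each edge is a multiple, by at most [n], of the quarter turn of a primitive generator, and the
    generators have determinant at most [m]. The pair [v1], [v2] behind [cone_mult] is an unknown
    choice, so it must first be matched with the edges. *)
Lemma corner_le (m n : nat) : (boundary P `&` lattice R) #<= `I_n ->
  lattice_vertex s b -> (mult P <= m)%N -> cross u w <= n%:Z * n%:Z * m%:Z.
Proof.
move=> Pn bv Pm.
have := leq_trans (cone_mult_le_mult bv) Pm; rewrite /cone_mult.
set S := [set d | _].
have : S (xget 0%N S).
  apply: xgetPex; have [v1 [v2 vg]] := corner_primitive_generators.
  by exists `|\det (row_mx v1 v2 : 'M[int]_2)|%N, v1, v2.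
move: (xget 0%N S) => d [v1 [v2 [[p1 p2 gen] ->]]].
rewrite det_row_mx2 => dm.
have mem1 : normal_cone P (realify R b) (realify R v1).
  by rewrite gen; exists 1, 0; rewrite scale1r scale0r addr0.
have mem2 : normal_cone P (realify R b) (realify R v2).
  by rewrite gen; exists 0, 1; rewrite scale1r scale0r add0r.
have pairing_int (z : 'rV[int]_2) (v : 'cV[int]_2) :
    pairing (realify R z) (realify R v) = (z 0 0 * v 0 0 + z 0 1 * v 1 0)%:~R.
  by rewrite pairingE !mxE rmorphD !rmorphM.
(* The conormal of [z] is a nonnegative combination of [v1] and [v2] on which [z] vanishes; as [z]
   has constant sign on the cone, it vanishes on a generator with nonzero coefficient. *)
have vanish (z : 'rV[int]_2) (sg : R) : z != 0 -> sg != 0 ->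
    normal_cone P (realify R b) (realify R (conormal z)) ->
    (forall v, normal_cone P (realify R b) v -> 0 <= sg * pairing (realify R z) v) ->
    z 0 0 * v1 0 0 + z 0 1 * v1 1 0 = 0 \/ z 0 0 * v2 0 0 + z 0 1 * v2 1 0 = 0.
  move=> z0 sg0 + zge; rewrite gen => -[x [y [x0 y0 e]]].
  have q1 := zge _ mem1; have q2 := zge _ mem2.
  have : x * (sg * pairing (realify R z) (realify R v1))
      + y * (sg * pairing (realify R z) (realify R v2)) = 0.
    transitivity (sg * pairing (realify R z) (realify R (conormal z))).
      by rewrite e !pairingE !mxE; ring.
    by rewrite conormal_realify pairing_conormal crossvv mulr0.
  move=> /eqP; rewrite paddr_eq0; [|exact: mulr_ge0..].
  rewrite !mulf_eq0 (negbTE sg0) /=.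
  rewrite !pairing_int !intr_eq0 => /andP[/orP[/eqP xz|/eqP->]]; last by left.
  case/orP => [/eqP yz|/eqP->]; last by right.
  case/eqP: (realify_neq0 z0); move: e; rewrite xz yz !scale0r addr0.
  move=> /matrixP e; apply: row2P; rewrite [RHS]mxE.
    by have := e 1 0; rewrite !mxE.
  by have := e 0 0; rewrite !mxE /= => /eqP; rewrite rmorphN oppr_eq0 => /eqP.
have fin (v v' : 'cV[int]_2) : primitive v -> primitive v' ->
    `|v 0 0 * v' 1 0 - v 1 0 * v' 0 0| <= m%:Z ->
    u 0 0 * v 0 0 + u 0 1 * v 1 0 = 0 -> w 0 0 * v' 0 0 + w 0 1 * v' 1 0 = 0 ->
    cross u w <= n%:Z * n%:Z * m%:Z.
  move=> pv pv' vm /(primitive_annihilator pv)[l1 uE].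
  move=> /(primitive_annihilator pv')[l2 wE].
  have h1 := lattice_length_le Pn ab uE; have h2 := lattice_length_le Pn bc wE.
  rewrite -(gtr0_norm uw).
  have -> : cross u w = l1 * l2 * (v 0 0 * v' 1 0 - v 1 0 * v' 0 0).
    by rewrite uE wE crossZl crossZr /cross !mxE /=; ring.
  by rewrite !normrM; apply: ler_pM => //; apply: ler_pM.
have u0 : u != 0 by apply: contraTneq uw => ->; rewrite crossC cross0r.
have w0 : w != 0 by apply: contraTneq uw => ->; rewrite cross0r.
have zu : u 0 0 * v1 0 0 + u 0 1 * v1 1 0 = 0 \/ u 0 0 * v2 0 0 + u 0 1 * v2 1 0 = 0.
  have n1 : -1 != 0 :> R by rewrite oppr_eq0 oner_eq0.
  apply: (vanish u (-1) u0 n1).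
    apply/normal_coneP; rewrite conormal_realify !pairing_conormal.
    by rewrite !cross_realify crossvv ler0z ltW.
  by move=> v /normal_coneP[_]; rewrite mulN1r oppr_ge0.
have zw : w 0 0 * v1 0 0 + w 0 1 * v1 1 0 = 0 \/ w 0 0 * v2 0 0 + w 0 1 * v2 1 0 = 0.
  apply: (vanish w 1 w0 (oner_neq0 R)).
    apply/normal_coneP; rewrite conormal_realify !pairing_conormal.
    by rewrite !cross_realify crossvv (crossC w) rmorphN oppr_le0 !ler0z lexx ltW.
  by move=> v /normal_coneP[+ _]; rewrite mul1r.
have dm' : `|v1 0 0 * v2 1 0 - v1 1 0 * v2 0 0| <= m%:Z by rewrite -abszE lez_nat.
have dm'' : `|v2 0 0 * v1 1 0 - v2 1 0 * v1 0 0| <= m%:Z.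
  by rewrite -normrN opprB mulrC [X in _ - X]mulrC.
(* For the case that both edges are matched with the same generator. *)
have self (v : 'cV[int]_2) : `|v 0 0 * v 1 0 - v 1 0 * v 0 0| <= m%:Z.
  by rewrite mulrC subrr normr0.
by case: zu => zu; case: zw => zw; apply: fin zu zw.
Qed.
End Corner.

End Geometry.

(** * Normal form and finiteness *)

Section Unimodular.

Lemma mulmx2E (K : comNzRingType) (p q : nat)
    (M : 'M[K]_(p, 2)) (N : 'M[K]_(2, q)) i j :
  (M *m N) i j = M i 0 * N 0 j + M i 1 * N 1 j.
Proof.
rewrite mxE !big_ord_recl big_ord0 addr0.
by congr (_ * _ + M i _ * N _ j); apply: val_inj.
Qed.

Lemma cross_mulmx (K : comNzRingType) (x y : 'rV[K]_2) (g : 'M[K]_2) :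
  cross (x *m g) (y *m g) = cross x y * (g 0 0 * g 1 1 - g 0 1 * g 1 0).
Proof. by rewrite /cross !mulmx2E; ring. Qed.

(** Hermite normal form: a Bézout relation sends the direction of [u] to the first axis, and a shear
    reduces [w]. *)
Lemma unimodular_normal_form (u w : 'rV[int]_2) : 0 < cross u w ->
  exists g h : 'M[int]_2,
  [/\ g *m h = 1%:M, h *m g = 1%:M,
      forall x y, cross (x *m g) (y *m g) = cross x y,
      0 < (u *m g) 0 0 /\ (u *m g) 0 1 = 0
    & 0 <= (w *m g) 0 0 < (w *m g) 0 1].
Proof.
move=> uw.
have u0 : u != 0 by apply: contraTneq uw => ->; rewrite crossC cross0r.
have [l [u' [l0 uE /primitive_bezout[a [b]]]]] := primitive_direction u0.
rewrite !mxE /= => ab.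
pose c := cross u' w.
have c0 : 0 < c by move: uw; rewrite uE crossZl pmulr_rgt0.
(* Subtracting [t] times the second column of [g] from the first reduces the first coordinate of
   [w *m g] modulo [c]. *)
pose t := divz (w 0 0 * b - w 0 1 * a) c.
pose al := b + t * u' 0 1; pose be := - a - t * u' 0 0.
have ab' : al * u' 0 0 + be * u' 0 1 = 1.
  by rewrite -ab /al /be; ring.
pose g : 'M[int]_2 := \matrix_(i, j)
  (if j == 0 then (if i == 0 then al else be)
   else (if i == 0 then - u' 0 1 else u' 0 0)).
pose h : 'M[int]_2 := \matrix_(i, j)
  (if i == 0 then u' 0 j else (if j == 0 then - be else al)).
exists g, h; split.
- apply/matrixP => i j; rewrite mulmx2E.
  have [->|->] := ord2P i; have [->|->] := ord2P j; rewrite !mxE /= -?ab'; ring.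
- apply/matrixP => i j; rewrite mulmx2E.
  have [->|->] := ord2P i; have [->|->] := ord2P j; rewrite !mxE /= -?ab'; ring.
- move=> x y; rewrite cross_mulmx -[RHS]mulr1 -ab' !mxE /=; ring.
- rewrite !mulmx2E uE !mxE /=; split; last by ring.
  rewrite (_ : _ + _ = l); first by [].
  transitivity (l * (al * u' 0 0 + be * u' 0 1)); first by ring.
  by rewrite ab' mulr1.
- rewrite !mulmx2E !mxE /=.
  have -> : w 0 0 * (- u' 0 1) + w 0 1 * u' 0 0 = c by rewrite /c /cross; ring.
  have -> : w 0 0 * al + w 0 1 * be = modz (w 0 0 * b - w 0 1 * a) c.
    by rewrite /modz -/t /al /be /c /cross; ring.
  by rewrite modz_ge0 ?lt0r_neq0 //= ltz_pmod.
Qed.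

(** The edges are [(l, 0)] and [(a, b)], the second starting at [(l, 0)]. Both [l] and [b] are at
    most [D]; the first strip bounds [y1], and then the second bounds [b * (y0 - l)]. *)
Lemma normalised_box (D G l a b y0 y1 : int) :
  0 < l -> 0 <= a < b -> l * b <= D ->
  0 <= l * y1 <= G -> 0 <= a * y1 - b * (y0 - l) <= G ->
  `|y0| <= D + D * G + G /\ `|y1| <= D + D * G + G.
Proof.
move=> l0 /andP[a0 ab] lbD /andP[y1l y1u] /andP[wl wu].
have b0 : 0 < b := le_lt_trans a0 ab.
have lD : l <= D by apply: le_trans lbD; rewrite ler_peMr -?gtz0_ge1 // ltW.
have bD : b <= D by apply: le_trans lbD; rewrite ler_peMl -?gtz0_ge1 // ltW.
have D0 : 0 < D := lt_le_trans b0 bD.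
have y10 : 0 <= y1 by rewrite -(pmulr_rge0 _ l0).
have y1G : y1 <= G by apply: le_trans y1u; rewrite ler_peMl -?gtz0_ge1.
have G0 : 0 <= G := le_trans y10 y1G.
have ay0 : 0 <= a * y1 by rewrite mulr_ge0.
have ayD : a * y1 <= D * G by rewrite ler_pM // (le_trans (ltW ab)).
have DG0 : 0 <= D * G by rewrite mulr_ge0 // ltW.
have : `|b * (y0 - l)| <= D * G + G.
  move: (b * (y0 - l)) (a * y1) (D * G) wl wu ay0 ayD DG0 G0; clear; lia.
have le_b : `|y0 - l| <= `|b * (y0 - l)|.
  by rewrite normrM ler_peMl // gtr0_norm // -gtz0_ge1.
move=> /(le_trans le_b).
move: (D * G) DG0 D0 G0 lD l0 y10 y1G; clear; lia.
Qed.

End Unimodular.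

Section Classes.
Variable R : realType.
Implicit Types (P Q : set 'rV[R]_2) (A : set 'rV[int]_2).

(** Equivalences are carried over by composing with the affine lattice bijection [f] or its inverse
    [f']. *)
Lemma integral_class_unimodular A (c : 'rV[int]_2) (g h : 'M[int]_2) :
  g *m h = 1%:M -> h *m g = 1%:M ->
  integral_class (conv_hull (realify R @` A)) =
  integral_class (conv_hull (realify R @` ((fun x => (x - c) *m g) @` A))).
Proof.
move=> gh hg.
pose gr := realify R g; pose hr := realify R h; pose cr := realify R c.
have realM p q r (M : 'M[int]_(p, q)) (N : 'M[int]_(q, r)) :
    realify R (M *m N) = realify R M *m realify R N by exact: map_mxM.
have ghr : gr *m hr = 1%:M by rewrite -realM gh /realify map_mx1.
have hgr : hr *m gr = 1%:M by rewrite -realM hg /realify map_mx1.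
pose f (x : 'rV[R]_2) := (x - cr) *m gr.
pose f' (y : 'rV[R]_2) := y *m hr + cr.
have ff' : cancel f f' by move=> x; rewrite /f /f' -mulmxA ghr mulmx1 subrK.
have f'f : cancel f' f by move=> x; rewrite /f /f' addrK -mulmxA hgr mulmx1.
have affine_comp (k1 k2 : 'rV[R]_2 -> 'rV[R]_2) :
    affine_map k1 -> affine_map k2 -> affine_map (k2 \o k1).
  move=> [L1 [b1 ->]] [L2 [b2 ->]].
  exists (L2 \o L1 : {linear 'rV[R]_2 -> 'rV[R]_2}), (L2 b1 + b2).
  by apply/funext => x /=; rewrite linearD addrA.
have f_aff : affine_map f.
  exists (mulmxr gr : {linear 'rV[R]_2 -> 'rV[R]_2}), (- cr *m gr).
  by apply/funext => x /=; rewrite /f mulmxDl.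
have f'_aff : affine_map f'.
  by exists (mulmxr hr : {linear 'rV[R]_2 -> 'rV[R]_2}), cr.
have f_lat x : lattice R x -> lattice R (f x).
  by move=> [z _ <-]; exists ((z - c) *m g) => //; rewrite realM realifyB.
have f'_lat x : lattice R x -> lattice R (f' x).
  by move=> [z _ <-]; exists (z *m h + c) => //; rewrite realifyD realM.
have bij (k k' : 'rV[R]_2 -> 'rV[R]_2) : cancel k k' -> cancel k' k ->
    (forall x, lattice R x -> lattice R (k x)) ->
    (forall x, lattice R x -> lattice R (k' x)) ->
    set_bij (lattice R) (lattice R) k.
  move=> kk' k'k kl k'l; split => //.
    by move=> x y _ _ /(can_inj kk').
  by move=> y /k'l yl; exists (k' y).
have f_hull B : f @` conv_hull B = conv_hull (f @` B).
  (* As the weights sum to one, the translation passes through the combination. *)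
  have fsum k (p : 'I_k -> 'rV[R]_2) (w : 'I_k -> R) : \sum_i w i = 1 ->
      f (\sum_i w i *: p i) = \sum_i w i *: f (p i).
    move=> w1; rewrite /f -[cr in LHS]scale1r -w1 scaler_suml -sumrB mulmx_suml.
    by apply: eq_bigr => i _; rewrite -scalerBr -scalemxAl.
  apply/seteqP; split => [_ [_ [k [p [w [Bp w0 w1 ->]]]] <-]|].
    exists k, (f \o p), w; split => //; last exact: fsum.
    by move=> i; exists (p i).
  move=> _ [k [p [w [Bp w0 w1 ->]]]].
  exists (\sum_i w i *: f' (p i)).
    exists k, (f' \o p), w; split => // i /=.
    by have [x Bx <-] := Bp i; rewrite ff'.
  by rewrite fsum //; apply: eq_bigr => i _; rewrite f'f.
set P := conv_hull (realify R @` A).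
have -> : conv_hull (realify R @` ((fun x => (x - c) *m g) @` A)) = f @` P.
  rewrite f_hull; congr conv_hull; rewrite !image_comp.
  by apply: eq_imagel => x _ /=; rewrite realM realifyB.
apply/seteqP; split => Q [Qp [k [kaff kbij kP]]]; split => //.
  exists (k \o f'); split; first exact: affine_comp.
    by apply: set_bij_comp kbij; apply: (bij f' f).
  rewrite -kP image_comp; apply: eq_imagel => x _ /=.
  by rewrite ff'.
exists (k \o f); split; first exact: affine_comp.
  by apply: set_bij_comp kbij; apply: (bij f f').
by rewrite -kP image_comp.
Qed.

Lemma polygon_normal_form (m n : nat) : exists N : nat,
  forall P, @mn_polygon R m n P ->
  exists2 A : set 'rV[int]_2, (forall x, A x -> `|x 0 0| <= N%:Z /\ `|x 0 1| <= N%:Z)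
    & integral_class P = integral_class (conv_hull (realify R @` A)).
Proof.
(* [D] bounds consecutive cross products, [F] all of them, and [G] the values
   [cross (E i) (x - p i)]; none depends on the polygon. *)
pose D : int := n%:Z * n%:Z * m%:Z.
have [F FP] := fan_bound n D.
pose G : int := n%:Z * n%:Z * F.
exists (absz (D + D * G + G)) => P [[[A0 [A0fin ->]] Pdim] Pn Pm].
have [s sE] := (finite_seqP A0).1 A0fin; rewrite sE in Pdim Pn Pm *.
(* Any nonzero vector would do; it serves to find two distinct points of [s]. *)
pose e : 'rV[int]_2 := const_mx 1.
have e0 : e != 0 by apply/eqP => /rowP /(_ 0); rewrite !mxE.
have nc u b u0 := @two_dimensional_noncollinear R s u b Pdim u0.
have [x0 x0s _] := nc e 0 e0.
have [x1 x1s x01] := nc e x0 e0.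
have nx01 : x0 != x1 by apply: contraNneq x01 => ->; rewrite subrr cross0r.
have [k [p [k0 pv pe pper pinj]]] := vertex_cycle x0s x1s nx01.
have kn : (k <= n)%N := lattice_vertices_le Pn pe pinj.
pose E i := p i.+1 - p i.
have E_gt0 i : 0 < cross (E i) (E i.+1).
  by apply: (consecutive_edges_gt0 _ (pe i) (pe i.+1)) => u; apply: nc.
have E_le i : cross (E i) (E i.+1) <= D.
  exact: (corner_le (pe i) (pe i.+1) (E_gt0 i) Pn (pv i.+1) Pm).
have Ifan := cycle_fan k0 pe pper pinj E_gt0 E_le.
have EF (a b : 'I_k) : `|cross (E a) (E b)| <= F.
  by apply: (FP _ _ _ _ Ifan); rewrite ?inE // cardsT card_ord.
have F0 : 0 <= F by apply: le_trans (EF (Ordinal k0) (Ordinal k0)).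
have box i x : x \in s -> 0 <= cross (E i) (x - p i) <= G.
  move=> xs; have /andP[-> h] /= := cycle_box k0 pe pper i xs EF.
  apply: (le_trans h); rewrite ler_wpM2r //.
  by apply: ler_pM; rewrite ?lez_nat.
have [g [h [gh hg gcross [l0 l1] ab]]] := unimodular_normal_form (E_gt0 0%N).
exists ((fun x => (x - p 0%N) *m g) @` [set` s]); last first.
  exact: integral_class_unimodular gh hg.
move=> _ [x /= xs <-]; set y := (x - p 0%N) *m g.
have DG (z : int) :
    `|z| <= D + D * G + G -> `|z| <= Posz (absz (D + D * G + G)).
  by move=> zD; rewrite abszE (le_trans zD) // ler_norm.
have H0 := box 0%N x xs; have H1 := box 1%N x xs.
suff [h0 h1] : `|y 0 0| <= D + D * G + G /\ `|y 0 1| <= D + D * G + G.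
  by split; apply: DG.
apply: (@normalised_box D G ((E 0%N *m g) 0 0) ((E 1%N *m g) 0 0)
  ((E 1%N *m g) 0 1)) => //.
- have := E_le 0%N; rewrite -gcross.
  by rewrite {1}/cross l1 mul0r subr0.
- move: H0; rewrite -gcross -/y.
  by rewrite {1 2}/cross l1 mul0r subr0.
- move: H1; rewrite -gcross.
  (* With [p 0] moved to the origin, the second edge starts at the image of [E 0], which lies on the
     first axis. *)
  have -> : (x - p 1%N) *m g = y - E 0%N *m g.
    by rewrite /y -mulmxBl /E opprB addrA subrK.
  have crossB_axis (v z t : 'rV[int]_2) : t 0 1 = 0 ->
      cross v (z - t) = v 0 0 * z 0 1 - v 0 1 * (z 0 0 - t 0 0).
    by move=> t1; rewrite /cross !mxE t1 subr0.
  by rewrite crossB_axis.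
Qed.

(** Subsets of the box are coded by finite sets of pairs of ordinals, shifted by [N] to allow
    negative coordinates. *)
Lemma finite_box_classes (N : nat) : finite_set
  [set integral_class (conv_hull (realify R @` A)) | A in
     [set A : set 'rV[int]_2 |
       forall x, A x -> `|x 0 0| <= N%:Z /\ `|x 0 1| <= N%:Z]].
Proof.
pose T := {set 'I_(N + N).+1 * 'I_(N + N).+1}.
pose pt (ij : 'I_(N + N).+1 * 'I_(N + N).+1) : 'rV[int]_2 :=
  \row_j (if j == 0 then ij.1%:Z - N%:Z else ij.2%:Z - N%:Z).
pose cl (S : T) := integral_class (conv_hull (realify R @` (pt @` [set` S]))).
apply: (@sub_finite_set _ _ (cl @` setT)); last exact/finite_image/finite_finset.
move=> _ [A AN <-]; exists [set ij | `[< A (pt ij) >]]%SET => //.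
rewrite /cl; congr (integral_class (conv_hull (_ @` _))).
apply/seteqP; split => [_ [ij + <-]|x Ax].
  by rewrite /= inE => /asboolP.
have [b0 b1] := AN x Ax.
have lt (z : int) : `|z| <= N%:Z -> (absz (z + N%:Z)%R < (N + N).+1)%N by clear; lia.
pose ij := (Ordinal (lt _ b0), Ordinal (lt _ b1)).
have ptE : pt ij = x.
  by apply: row2P; rewrite !mxE /=; lia.
by exists ij => //=; rewrite inE; apply/asboolP; rewrite ptE.
Qed.

End Classes.

Theorem theorem19 (R : realType) (m n : nat)
    (hm : (0 < m)%N) (hn : (0 < n)%N) :
  finite_set [set integral_class P | P in @mn_polygon R m n].
Proof.
have [N NP] := polygon_normal_form R m n.
apply: sub_finite_set (finite_box_classes R N) => _ [P /NP[A AN PA] <-].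
by exists A.
Qed.
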